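(* The nullity space and the kernel space of the h-curvature $R$ of the Cartan connection do not coincide in general. That is, there exist a Finsler manifold $(M,F)$ and a point $z\in\mathcal{D}$, $x=\pi(z)$ (where $\mathcal{D}$ is the domain of $F$), such that, as subspaces of $T_xM$, $$\mathcal{N}_R(x)\neq \mathrm{Ker}_R(x),$$ where $\mathcal{N}_R(x)$ and $\mathrm{Ker}_R(x)$ are computed at $z$.
   Context: **Finsler manifold.** $M$ is a smooth manifold and $\pi$ denotes the projection of the bundle of nonzero tangent vectors of $M$ onto $M$. A Finsler function $F$ is a smooth positive function on a nonempty open set $\mathcal{D}$ of nonzero tangent vectors that is conic (invariant under $y\mapsto ty$, $t>0$). $F$ is positively homogeneous of degree 1 in $y$, and the Finsler metric $g_{ij}=\frac12\frac{\partial^2F^2}{\partial y^i\partial y^j}$ is nondegenerate on $\mathcal{D}$. The classical case is that $\mathcal{D}$ consists of all nonzero tangent vectors and $g$ is positive definite. All objects below live over $\mathcal{D}$. **Pullback bundle.** $\pi^{-1}(TM)\to\mathcal{D}$ is the pullback of $TM$ along $\pi$, with fiber $\{z\}\times T_{\pi z}M\simeq T_{\pi z}M$ at $z$. Sections of it are called $\pi$-vector fields and are denoted by barred letters. The Finsler metric $g$ is a metric on this bundle. For a vector (field) $X$ on $\mathcal{D}$, put $\overline{X}=\pi_*X$, where $\pi_*$ is the tangent map of $\pi$, regarded as taking values in $\pi^{-1}(TM)$. The fundamental $\pi$-vector field is $\overline{\eta}(z)=(z,z)$. **Regular connections.** Let $D$ be a linear connection on $\pi^{-1}(TM)$ and let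 $K(X)=D_X\overline{\eta}$. Put $V_z=\ker(\pi_* )_z$ (vertical space) and $H_z=\{X\in T_z\mathcal{D}: K(X)=0\}$ (horizontal space). $D$ is regular if $T_z\mathcal{D}=V_z\oplus H_z$ for all $z\in\mathcal{D}$. Then $\pi_*:H_z\to T_{\pi z}M$ and $K:V_z\to T_{\pi z}M$ are isomorphisms. **Torsion and curvature.** The classical torsion and curvature are $\mathbf{T}(X,Y)=D_X\overline{Y}-D_Y\overline{X}-\pi_*[X,Y]$ and $\mathbf{K}(X,Y)\overline{Z}=D_XD_Y\overline{Z}-D_YD_X\overline{Z}-D_{[X,Y]}\overline{Z}$. The (h)hv-torsion is $T(\overline{X},\overline{Y})=\mathbf{T}(X',Y')$, where $X'$ is the vertical vector with $K(X')=\overline{X}$ and $Y'$ is the horizontal vector with $\pi_*Y'=\overline{Y}$. The h-curvature is $R(\overline{X},\overline{Y})\overline{Z}=\mathbf{K}(X'',Y'')\overline{Z}$, where $X'',Y''$ are the horizontal vectors with $\pi_*X''=\overline{X}$, $\pi_*Y''=\overline{Y}$. **Cartan connection.** The Cartan connection $\nabla$ of $(M,F)$ is the unique regular connection on $\pi^{-1}(TM)$ that is metrical ($\nabla g=0$), satisfies $\mathbf{T}(X,Y)=0$ for all horizontal $X,Y$, and satisfies $g(T(\overline{X},\overline{Y}),\overline{Z})=g(T(\overline{X},\overline{Z}),\overline{Y})$. $R$ denotes its h-curvature. **Nullity and kernel.** For $z\in\mathcal{D}$ and $x=\pi z$: - $\mathcal{N}_R(z)=\{X\in H_z: R(\overline{X},\overline{Y})=0\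 \text{ for all } Y\in H_z\}$, and the nullity space is $\mathcal{N}_R(x)=\pi_*(\mathcal{N}_R(z))\subset T_xM$. - The kernel space is $\mathrm{Ker}_R(x)=\{\overline{X}\in\{z\}\times T_xM\simeq T_xM: R(\overline{Y},\overline{Z})\overline{X}=0\ \text{ for all } Y,Z\in H_z\}$. Both spaces depend on the chosen $z$ over $x$. *)

(* Defs.v *)
From HB Require Import structures.
From mathcomp Require Import all_boot all_order all_algebra.
From mathcomp Require Import all_classical all_reals all_analysis.

Set Implicit Arguments.
Unset Strict Implicit.
Unset Printing Implicit Defensive.
Import Order.TTheory GRing.Theory Num.Theory.
Import numFieldNormedType.Exports.

Local Open Scope classical_set_scope.
Local Open Scope ring_scope.

Section Smooth.
Context {R : realType} {V W : normedModType R}.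

Fixpoint Ck (k : nat) (A : set V) (f : V -> W) : Prop :=
  match k with
  | 0 => forall x, A x -> {for x, continuous f}
  | k'.+1 => (forall x, A x -> differentiable f x) /\
             (forall v, Ck k' A (fun x => 'D_v f x))
  end.

(* Only meaningful for open A: the derivatives are those of the total
   function f, so they see f on a whole neighbourhood of each point of A. *)
Definition smooth_on (A : set V) (f : V -> W) := forall k, Ck k A f.

End Smooth.

(* The underlying set of the manifold is [carrier A], the union of the chart
   domains; [point A] may be larger.  [chart_inv i] is an inverse of [chart i]
   on the image of its domain and is arbitrary elsewhere. *)
Record atlas (R : realType) (E : normedModType R) := Atlas {
  point :> Type;
  index : Type;
  chart_dom : index -> set point;
  chart : index -> point -> E;
  chart_inv : index -> E -> point }.

Arguments chart_dom {R E} A i _ : rename.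
Arguments chart {R E} A i _ : rename.
Arguments chart_inv {R E} A i _ : rename.

Section Atlas.
Context {R : realType} {E : normedModType R}.
Variable A : atlas E.
Implicit Types (i j : index A) (p : A).

Definition carrier : set A := [set p | exists i, chart_dom A i p].

Definition transition i j : E -> E := chart A j \o chart_inv A i.

Definition atlas_open (U : set A) :=
  U `<=` carrier /\ forall i, open (chart A i @` (chart_dom A i `&` U)).

(* The clauses say, in order: charts are injective, their overlaps are open in
   the model space, transitions are smooth, and the topology defined by the
   charts is Hausdorff and second countable. *)
Definition is_smooth_manifold :=
  [/\ forall i p, chart_dom A i p -> chart_inv A i (chart A i p) = p,
      forall i j, open (chart A i @` (chart_dom A i `&` chart_dom A j)),
      forall i j, smooth_on (chart A i @` (chart_dom A i `&` chart_dom A j))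
                            (transition i j),
      forall p q, carrier p -> carrier q -> p <> q ->
        exists U V, [/\ atlas_open U, atlas_open V, U p, V q &
                        U `&` V = set0]
    & exists J : nat -> option (index A),
        forall p, carrier p ->
          exists m i, J m = Some i /\ chart_dom A i p].

(* A tangent vector at p is the family of its components in all the charts
   around p, subject to the usual transformation law; the components in the
   charts that do not contain p are set to 0, so that equality of tangent
   vectors is equality of families. *)
Definition tangent p : set (index A -> E) :=
  [set v | forall i,
     (~ chart_dom A i p -> v i = 0) /\
     (forall j, chart_dom A i p -> chart_dom A j p ->
        v j = 'd (transition i j) (chart A i p) (v i))].

Definition smooth_fun {W : normedModType R} (f : A -> W) :=
  forall i, smooth_on (chart A i @` chart_dom A i) (f \o chart_inv A i).

(* The derivative of f at p along X, computed in the chart i. *)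
Definition deriv_along {W : normedModType R} (f : A -> W) i p
    (X : index A -> E) : W :=
  'D_(X i) (f \o chart_inv A i) (chart A i p).

Definition vector_field (X : A -> index A -> E) :=
  (forall p, carrier p -> tangent p (X p)) /\
  (forall i, smooth_on (chart A i @` chart_dom A i)
                       (fun u => X (chart_inv A i u) i)).

(* In a chart, [X, Y] = DY(X) - DX(Y). *)
Definition bracket (X Y : A -> index A -> E) : A -> index A -> E :=
  fun p i =>
    if `[< chart_dom A i p >] then
      deriv_along (fun q => Y q i) i p (X p) -
      deriv_along (fun q => X q i) i p (Y p)
    else 0.

Definition restrict (U : set A) : atlas E :=
  @Atlas R E A (index A) (fun i => chart_dom A i `&` U)
    (chart A) (chart_inv A).

End Atlas.

Arguments carrier {R E} A _.
Arguments transition {R E} A i j _.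
Arguments atlas_open {R E} A U.
Arguments is_smooth_manifold {R E} A.
Arguments tangent {R E} A p _.
Arguments smooth_fun {R E} A {W} f.
Arguments deriv_along {R E} A {W} f i p X.
Arguments vector_field {R E} A X.
Arguments bracket {R E} A X Y _ _.
Arguments restrict {R E} A U.

Section TangentBundle.
Context {R : realType} {E : normedModType R}.
Variable M : atlas E.

Definition tangent_bundle : atlas (E * E)%type :=
  @Atlas R (E * E)%type (M * (index M -> E))%type (index M)
    (fun i => [set z | chart_dom M i z.1 /\ tangent M z.1 z.2])
    (fun i z => (chart M i z.1, z.2 i))
    (fun i u => (chart_inv M i u.1,
       fun j => if `[< chart_dom M j (chart_inv M i u.1) >]
                then 'd (transition M i j) (u.1) (u.2) else 0)).

End TangentBundle.

Section Finsler.
Context {R : realType} {n : nat}.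
Notation E := 'rV[R]_n.
Variable M : atlas E.

Notation TM := (M * (index M -> E))%type.
Notation vec := (index M -> E).
Notation vec2 := (index M -> E * E).

Variable D : set TM.

(* The open set D of TM, as a manifold of its own. *)
Definition dom_atlas : atlas (E * E)%type := restrict (tangent_bundle M) D.

Notation DM := dom_atlas.

(* The vertical Hessian of F^2 / 2, i.e. the bilinear form with matrix
   (1/2) d^2 F^2 / dy^i dy^j. *)
Definition finsler_metric (F : TM -> R) (z : TM) (u v : vec) : R :=
  2^-1 * derive1 (fun s : R =>
    derive1 (fun t : R => F (z.1, z.2 + s *: u + t *: v) ^+ 2) 0) 0.

Record is_finsler (F : TM -> R) : Prop := IsFinsler {
  finsler_open : atlas_open (tangent_bundle M) D;
  finsler_nonempty : D !=set0;
  finsler_nonzero : forall z, D z -> z.2 <> 0;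
  finsler_conic : forall z (t : R), D z -> 0 < t -> D (z.1, t *: z.2);
  finsler_smooth : smooth_fun DM F;
  finsler_pos : forall z, D z -> 0 < F z;
  finsler_homogeneous : forall z (t : R), D z -> 0 < t ->
    F (z.1, t *: z.2) = t * F z;
  finsler_nondegenerate : forall z u, D z -> tangent M z.1 u ->
    (forall v, tangent M z.1 v -> finsler_metric F z u v = 0) -> u = 0 }.

Definition pi_field (Y : TM -> vec) :=
  (forall z, D z -> tangent M z.1 (Y z)) /\
  (forall i : index M,
     smooth_on (chart DM i @` chart_dom DM i)
               (fun w => Y (chart_inv DM i w) i)).

Definition pi_push (X : vec2) : vec := fun i => (X i).1.

Definition eta : TM -> vec := fun z => z.2.

(* [nabla z X Y] is the derivative at z of the section Y of the pullback
   bundle in the direction X, a tangent vector of D at z. *)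
Definition pi_connection := TM -> vec2 -> (TM -> vec) -> vec.

Record is_linear_connection (nabla : pi_connection) : Prop :=
  IsLinearConnection {
  conn_tangent : forall z X Y, D z -> tangent DM z X -> pi_field Y ->
    tangent M z.1 (nabla z X Y);
  (* Sections are total functions here; their values outside D are junk. *)
  conn_ext : forall z X Y Y', D z -> tangent DM z X ->
    pi_field Y -> pi_field Y' -> (forall w, D w -> Y w = Y' w) ->
    nabla z X Y = nabla z X Y';
  conn_linear : forall z (a : R) X X' Y, D z ->
    tangent DM z X -> tangent DM z X' -> pi_field Y ->
    nabla z (a *: X + X') Y = a *: nabla z X Y + nabla z X' Y;
  conn_add : forall z X Y Y', D z -> tangent DM z X ->
    pi_field Y -> pi_field Y' ->
    nabla z X (fun w => Y w + Y' w) = nabla z X Y + nabla z X Y';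
  conn_leibniz : forall z X (f : TM -> R) Y (i : index M),
    D z -> tangent DM z X -> smooth_fun DM f -> pi_field Y ->
    chart_dom M i z.1 ->
    nabla z X (fun w => f w *: Y w) =
      deriv_along DM f i z X *: Y z + f z *: nabla z X Y;
  conn_smooth : forall X Y, vector_field DM X -> pi_field Y ->
    pi_field (fun z => nabla z (X z) Y) }.

Section Connection.
Variable nabla : pi_connection.

Definition connection_map (z : TM) (X : vec2) : vec := nabla z X eta.

Definition vertical (z : TM) : set vec2 :=
  [set X | tangent DM z X /\ pi_push X = 0].

Definition horizontal (z : TM) : set vec2 :=
  [set X | tangent DM z X /\ connection_map z X = 0].

Definition is_regular := forall z, D z ->
  (forall X, tangent DM z X -> exists X1 X2,
     [/\ vertical z X1, horizontal z X2 & X = X1 + X2]) /\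
  vertical z `&` horizontal z = [set 0].

Definition torsion (X Y : TM -> vec2) (z : TM) : vec :=
  nabla z (X z) (fun w => pi_push (Y w)) -
  nabla z (Y z) (fun w => pi_push (X w)) -
  pi_push (bracket DM X Y z).

Definition curvature (X Y : TM -> vec2) (Z : TM -> vec) (z : TM) : vec :=
  nabla z (X z) (fun w => nabla w (Y w) Z) -
  nabla z (Y z) (fun w => nabla w (X w) Z) -
  nabla z (bracket DM X Y z) Z.

(* For a regular connection, the only vertical (resp. horizontal) vector at z
   whose image under K (resp. the projection) is x. *)
Definition vlift (z : TM) (x : vec) : vec2 :=
  xget 0 [set X | vertical z X /\ connection_map z X = x].

Definition hlift (z : TM) (x : vec) : vec2 :=
  xget 0 [set X | horizontal z X /\ pi_push X = x].

Definition hv_torsion (X Y : TM -> vec) : TM -> vec :=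
  torsion (fun z => vlift z (X z)) (fun z => hlift z (Y z)).

Definition h_curvature (X Y Z : TM -> vec) : TM -> vec :=
  curvature (fun z => hlift z (X z)) (fun z => hlift z (Y z)) Z.

Record is_cartan (F : TM -> R) : Prop := IsCartan {
  cartan_linear : is_linear_connection nabla;
  cartan_regular : is_regular;
  cartan_metrical : forall z X Y Z (i : index M), D z ->
    tangent DM z X -> pi_field Y -> pi_field Z -> chart_dom M i z.1 ->
    deriv_along DM (fun w => finsler_metric F w (Y w) (Z w)) i z X =
      finsler_metric F z (nabla z X Y) (Z z) +
      finsler_metric F z (Y z) (nabla z X Z);
  cartan_torsion : forall X Y, vector_field DM X ->
    vector_field DM Y ->
    (forall w, D w -> horizontal w (X w)) ->
    (forall w, D w -> horizontal w (Y w)) ->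
    forall z, D z -> torsion X Y z = 0;
  cartan_hv_torsion : forall X Y Z, pi_field X -> pi_field Y -> pi_field Z ->
    forall z, D z ->
    finsler_metric F z (hv_torsion X Y z) (Z z) =
    finsler_metric F z (hv_torsion X Z z) (Y z) }.

(* The h-curvature is tensorial, so its value on vectors at z is obtained from
   any sections extending them; [extend z x] picks one. *)
Definition extend (z : TM) (x : vec) : TM -> vec :=
  xget (cst 0) [set X | pi_field X /\ X z = x].

Definition h_curvature_at (z : TM) (x y w : vec) : vec :=
  h_curvature (extend z x) (extend z y) (extend z w) z.

Definition nullity_horizontal (z : TM) : set vec2 :=
  [set X | horizontal z X /\
     forall Y w, horizontal z Y -> tangent M z.1 w ->
       h_curvature_at z (pi_push X) (pi_push Y) w = 0].

Definition nullity_space (z : TM) : set vec :=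
  pi_push @` nullity_horizontal z.

Definition kernel_space (z : TM) : set vec :=
  [set w | tangent M z.1 w /\
     forall Y Z, horizontal z Y -> horizontal z Z ->
       h_curvature_at z (pi_push Y) (pi_push Z) w = 0].

End Connection.
End Finsler.

(* Main.v *)
Require Import Defs.
From HB Require Import structures.
From mathcomp Require Import all_boot all_order all_algebra.
From mathcomp Require Import all_classical all_reals all_analysis.
From mathcomp Require Import ring.

(** Take M = R^3 and the conic domain y_1, y_2, y_3 > 0 with
    F = e^(x_1 x_2) y_1 y_2 / y_3.  In the frame e_k = y_k d/dy_k the metric is
    F^2 G with G a constant matrix.  The Cartan connection is the one for which
    the e_k are horizontally parallel and which is, along the fibres, the
    Levi-Civita connection of the conformally flat metric F^2 G in the
    variables log y_k.  All its connection forms are therefore linear in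
      theta_1 = dy_1/y_1 + x_2 dx_1,  theta_2 = dy_2/y_2 + x_1 dx_2,
      theta_3 = dy_3/y_3,
    whose common kernel is the horizontal space.  Hence the h-curvature is the
    connection form applied to (d theta_1, d theta_2, d theta_3), where
    d theta_1 = - d theta_2 = - dx_1 /\ dx_2 and d theta_3 = 0.  So e_3 is in
    the nullity space, whereas R(e_1, e_2) e_3 = e_1 - e_2 at y = (1, 1, 1). *)

Set Implicit Arguments.
Unset Strict Implicit.
Unset Printing Implicit Defensive.
Import Order.TTheory GRing.Theory Num.Theory.
Import numFieldNormedType.Exports.

Local Open Scope classical_set_scope.
Local Open Scope ring_scope.

(** * Differentiability and C^k calculus on an open set *)

Lemma near_eq_differentiable {R : realType} {V W : normedModType R}
    (f g : V -> W) (x : V) :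
  (\near x, f x = g x) -> differentiable f x -> differentiable g x.
Proof.
(* The difference [g - f] vanishes near [x], so its expansion there is 0 + 0 + o(id), with
   differential the zero map; adding [f] back gives [g]. *)
move=> fg df; suff d : differentiable (g - f) x.
  by have := differentiableD d df; rewrite subrK.
have gfx : (g - f) x = 0 by rewrite /= -[LHS]/(g x - f x) (nbhs_singleton fg) subrr.
have zc : continuous (\0 : {linear V -> W}) by move=> y; exact: cvg_cst.
have e : (g - f) \o shift x = cst ((g - f) x) + (\0 : {linear V -> W}) +o_ 0 id.
  apply/eqaddoP => _/posnumP[e].
  have fg0 : \forall y \near (0 : V), f (y + x) = g (y + x).
    move: fg; rewrite (near_shift 0 x) /=.
    by under [X in X -> _]eq_near do rewrite subr0.
  near=> y.
  have -> : ((g - f) \o shift x - (cst ((g - f) x) + (\0 : {linear V -> W}))) y = 0.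
    rewrite gfx -[LHS]/((g (y + x) - f (y + x)) - (0 + 0)).
    have -> : f (y + x) = g (y + x) by near: y.
    by rewrite subrr addr0 subr0.
  by rewrite normr0 mulr_ge0.
by apply/diff_locallyP; rewrite (diff_unique zc e); split.
Unshelve. all: by end_near. Qed.

Lemma is_derive_linear_comp {R : realType} {V W W' : normedModType R}
    (L : {linear W -> W'}) (f : V -> W) (x v : V) :
  continuous L -> differentiable f x ->
  is_derive x v (fun y => L (f y)) (L ('D_v f x)).
Proof.
move=> Lc df.
have dL : differentiable L (f x) by exact: linear_differentiable.
have dLf : differentiable (L \o f) x by exact: differentiable_comp.
apply: DeriveDef; first exact: diff_derivable.
by rewrite (deriveE _ dLf) (deriveE _ df) (diff_comp df dL) /= diff_lin.
Qed.

Section CkTheory.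
Context {R : realType} {V : normedModType R}.
Variables (U : set V) (Uo : open U).

Lemma near_open (P : V -> Prop) x : U x -> (forall y, U y -> P y) -> \near x, P x.
Proof. by move=> Ux UP; near=> y; apply: UP; near: y; exact: open_nbhs_nbhs.
Unshelve. all: by end_near. Qed.

(** Since [U] is open, derivatives at its points see only the values on [U]. The closure lemmas
    below use this to replace a derivative by a formula that is valid on [U] alone. *)
Lemma Ck_eq {W : normedModType R} (f g : V -> W) k :
  (forall x, U x -> f x = g x) -> Ck k U f -> Ck k U g.
Proof.
elim: k f g => [|k IH] f g fg /=.
  move=> cf x Ux; rewrite /prop_for /continuous_at -fg //.
  exact: cvg_trans (near_eq_cvg (near_open Ux fg)) (cf x Ux).
move=> [df cf]; split=> [x Ux|v].
  by apply: near_eq_differentiable (df x Ux); exact: near_open fg.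
apply: IH (cf v) => x Ux; exact: near_eq_derive (near_open Ux fg).
Qed.

Lemma CkW {W : normedModType R} (f : V -> W) k : Ck k.+1 U f -> Ck k U f.
Proof.
elim: k f => [|k IH] f [df cf].
  by move=> x Ux; apply: differentiable_continuous; exact: df.
by split=> // v; apply: IH.
Qed.

Lemma Ck_cst {W : normedModType R} (c : W) k : Ck k U (cst c).
Proof.
elim: k c => [|k IH] c /=; first by move=> x _; exact: cvg_cst.
split=> // v; apply: Ck_eq (IH 0) => x _ /=; by rewrite derive_cst.
Qed.

Lemma CkD {W : normedModType R} (f g : V -> W) k :
  Ck k U f -> Ck k U g -> Ck k U (fun x => f x + g x).
Proof.
rewrite -[fun x => _]/(f + g).
elim: k f g => [|k IH] f g /=.
  by move=> cf cg x Ux; apply: cvgD; [exact: cf|exact: cg].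
move=> [df cf] [dg cg]; split=> [x Ux|v].
  by apply: differentiableD; [exact: df|exact: dg].
apply: Ck_eq (IH _ _ (cf v) (cg v)) => x Ux.
by rewrite deriveD;
  [|apply: diff_derivable; exact: df|apply: diff_derivable; exact: dg].
Qed.

(** The Leibniz formula pairs each derivative, of class C^k, with an undifferentiated factor of
    class C^(k+1), which [CkW] lowers to C^k for the induction. *)
Lemma CkM (f g : V -> R) k : Ck k U f -> Ck k U g -> Ck k U (fun x => f x * g x).
Proof.
rewrite -[fun x => _]/(f * g).
elim: k f g => [|k IH] f g.
  by move=> cf cg x Ux; apply: cvgM; [exact: cf|exact: cg].
move=> Cf Cg; have [df cf] := Cf; have [dg cg] := Cg; split=> [x Ux|v].
  by apply: differentiableM; [exact: df|exact: dg].
apply: Ck_eq (CkD (IH _ _ (CkW Cf) (cg v)) (IH _ _ (CkW Cg) (cf v))) => x Ux.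
by rewrite deriveM;
  [|apply: diff_derivable; exact: df|apply: diff_derivable; exact: dg].
Qed.

Lemma Ck_linear_comp {W W' : normedModType R} (L : {linear W -> W'})
    (f : V -> W) k :
  continuous L -> Ck k U f -> Ck k U (fun x => L (f x)).
Proof.
move=> Lc; elim: k f => [|k IH] f /=.
  by move=> cf x Ux; apply: continuous_comp; [exact: cf|exact: Lc].
move=> [df cf]; split=> [x Ux|v].
  by apply: differentiable_comp; [exact: df|exact: linear_differentiable].
apply: Ck_eq (IH _ (cf v)) => x Ux /=.
by have [_ ->] := is_derive_linear_comp v Lc (df x Ux).
Qed.

Lemma Ck_linear {W : normedModType R} (L : {linear V -> W}) k :
  continuous L -> Ck k U L.
Proof.
move=> Lc; case: k => [|k] /=; first by move=> x _; exact: Lc.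
split=> [x Ux|v]; first exact: linear_differentiable.
apply: Ck_eq (Ck_cst (L v) k) => x Ux /=.
by rewrite deriveE ?diff_lin //; exact: linear_differentiable.
Qed.

(** The derivative -(1/f)^2 Df again contains 1/f, so the induction is on [k] with [f] fixed: its
    hypothesis supplies 1/f one order lower. *)
Lemma CkV (f : V -> R) k : (forall x, U x -> f x != 0) ->
  Ck k U f -> Ck k U (fun x => (f x)^-1).
Proof.
move=> f0; elim: k => [|k IH].
  by move=> cf x Ux; apply: cvgV; [exact: f0|exact: cf].
move=> Cf; have [df cf] := Cf; split=> [x Ux|v].
  by apply: differentiableV; [exact: df|exact: f0].
have Ci := IH (CkW Cf).
have C := CkM (CkM (Ck_cst (-1 : R) k) (CkM Ci Ci)) (cf v).
apply: Ck_eq C => x Ux.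
rewrite deriveV; [|exact: f0|apply: diff_derivable; exact: df].
rewrite -[LHS]/(-1 * ((f x)^-1 * (f x)^-1) * 'D_v f x) mulN1r.
by rewrite -[RHS]/(- (f x)^-2 * _) expr2 invfM.
Qed.

Lemma CkN (f : V -> R) k : Ck k U f -> Ck k U (fun x => - f x).
Proof.
move=> Cf; apply: Ck_eq (CkM (Ck_cst (-1 : R) k) Cf) => x _ /=.
by rewrite /cst mulN1r.
Qed.

Lemma CkB (f g : V -> R) k :
  Ck k U f -> Ck k U g -> Ck k U (fun x => f x - g x).
Proof. by move=> Cf Cg; apply: CkD => //; exact: CkN. Qed.

Lemma derive_expR_comp (f : V -> R) x v : differentiable f x ->
  differentiable (expR \o f) x /\ 'D_v (expR \o f) x = expR (f x) * 'D_v f x.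
Proof.
move=> df; have de : differentiable expR (f x).
  by apply/derivable1_diffP; exact: derivable_expR.
split; first exact: differentiable_comp.
rewrite !deriveE //; last exact: differentiable_comp.
rewrite diff_comp //= derive.deriv1E /=; last exact: derivable_expR.
by rewrite -[LHS]/('d f x v * derive1 expR (f x)) derive1E derive_val mulrC.
Qed.

Lemma Ck_expR (f : V -> R) k : Ck k U f -> Ck k U (expR \o f).
Proof.
elim: k => [|k IH].
  by move=> cf x Ux; apply: continuous_comp; [exact: cf|exact: continuous_expR].
move=> Cf; have [df cf] := Cf; split=> [x Ux|v].
  by have [] := derive_expR_comp 0 (df x Ux).
apply: Ck_eq (CkM (IH (CkW Cf)) (cf v)) => x Ux.
by have [_ ->] := derive_expR_comp v (df x Ux).
Qed.

Lemma Ck_sum {W : normedModType R} I (r : seq I) (f : I -> V -> W) k :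
  (forall i, Ck k U (f i)) -> Ck k U (fun x => \sum_(i <- r) f i x).
Proof.
move=> Cf; elim: r => [|i r IH].
  by apply: Ck_eq (Ck_cst 0 k) => x _; rewrite big_nil.
by apply: Ck_eq (CkD (Cf i) IH) => x _; rewrite big_cons.
Qed.

Lemma smooth_onD {W : normedModType R} (f : V -> W) v :
  smooth_on U f -> smooth_on U (fun x => 'D_v f x).
Proof. by move=> sf k; have [_] := sf k.+1; apply. Qed.

Lemma smooth_on_diff {W : normedModType R} (f : V -> W) x :
  smooth_on U f -> U x -> differentiable f x.
Proof. by move=> sf; have [+ _] := sf 1; apply. Qed.

End CkTheory.

(** * Symmetry of second derivatives *)

Section Schwarz.
Context {R : realType} {V : normedModType R}.

(** The difference quotients agree as functions, so both the existence and the value of the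
    derivative pass between the line and the space. *)
Fact line_quotient (f : V -> R) (a u : V) (s : R) :
  (fun h : R => h^-1 *: (((fun t : R => f (a + t *: u)) \o shift s) (h *: 1)
                         - f (a + s *: u)))
  = (fun h => h^-1 *: ((f \o shift (a + s *: u)) (h *: u) - f (a + s *: u))).
Proof.
apply/funext => h /=; congr (_ *: (f _ - _)).
by rewrite [h%:A]mulr1 scalerDl addrCA.
Qed.

Lemma is_derive_line (f : V -> R) (a u : V) (s : R) :
  derivable f (a + s *: u) u ->
  is_derive s 1 (fun t : R => f (a + t *: u)) ('D_u f (a + s *: u)).
Proof. by move=> df; split; rewrite /derivable /derive line_quotient. Qed.

Lemma derive1_line (f : V -> R) (a u : V) :
  derive1 (fun t : R => f (a + t *: u)) 0 = 'D_u f a.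
Proof. by rewrite derive1E /derive line_quotient scale0r addr0. Qed.

(** The mean value theorem applied twice: in the direction [u] to the difference [phi] of [f] along
    two opposite sides, then in the direction [v] to the derivative along [u]. *)
Lemma second_difference (U : set V) (f : V -> R) (p u v : V) (h : R) :
  0 < h ->
  (forall s t, 0 <= s <= h -> 0 <= t <= h -> U (p + s *: u + t *: v)) ->
  (forall x, U x -> differentiable f x) ->
  (forall x, U x -> differentiable (fun y => 'D_u f y) x) ->
  exists s t, [/\ 0 <= s <= h, 0 <= t <= h &
    f (p + h *: u + h *: v) - f (p + h *: u) - (f (p + h *: v) - f p)
    = h ^+ 2 * 'D_v (fun y => 'D_u f y) (p + s *: u + t *: v)].
Proof.
move=> h0 HU df ddf.
have h0' : 0 <= h <= h by rewrite lexx ltW.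
have z0' : 0 <= (0 : R) <= h by rewrite lexx ltW.
pose phi s := f (p + h *: v + s *: u) - f (p + s *: u).
pose dphi s := 'D_u f (p + h *: v + s *: u) - 'D_u f (p + s *: u).
have dphiP s : 0 <= s <= h -> is_derive s 1 phi (dphi s).
  move=> sh; apply: is_deriveB; apply: is_derive_line;
    apply: diff_derivable; apply: df.
    by rewrite addrAC; exact: HU.
  by rewrite -[_ + _]addr0 -(scale0r v); exact: HU.
have [||s sh e1] := @MVT _ phi dphi 0 h h0.
- by move=> x; rewrite in_itv /= => /andP[x0 xh]; apply: dphiP; rewrite !ltW.
- apply: derivable_within_continuous => x; rewrite in_itv /= => xh.
  by have [] := dphiP x xh.
move: sh; rewrite in_itv /= => /andP[s0 sh].
have {s0 sh}sh : 0 <= s <= h by rewrite !ltW.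
pose psi t := 'D_u f (p + s *: u + t *: v).
pose dpsi t := 'D_v (fun y => 'D_u f y) (p + s *: u + t *: v).
have dpsiP t : 0 <= t <= h -> is_derive t 1 psi (dpsi t).
  move=> th; apply: (@is_derive_line (fun y => 'D_u f y)).
  by apply: diff_derivable; apply: ddf; exact: HU.
have [||t th e2] := @MVT _ psi dpsi 0 h h0.
- by move=> x; rewrite in_itv /= => /andP[x0 xh]; apply: dpsiP; rewrite !ltW.
- apply: derivable_within_continuous => x; rewrite in_itv /= => xh.
  by have [] := dpsiP x xh.
move: th; rewrite in_itv /= => /andP[t0 th].
exists s, t; split; rewrite ?sh ?ltW //.
transitivity (phi h - phi 0).
  by rewrite /phi scale0r !addr0 [p + h *: v + _]addrAC.
rewrite e1 subr0 /dphi.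
transitivity ((psi h - psi 0) * h).
  by rewrite /psi scale0r !addr0 [p + h *: v + _]addrAC.
rewrite e2 subr0 /dpsi; ring.
Qed.

(** The second difference over the parallelogram with sides h u and h v is symmetric in [u] and [v].
    Hence the two mixed derivatives agree, each at its own intermediate point, and by continuity
    both values are within e/2 of the values at [p]. *)
Lemma derive_comm (U : set V) (f : V -> R) (p u v : V) :
  open U -> Ck 2 U f -> U p ->
  'D_v (fun x => 'D_u f x) p = 'D_u (fun x => 'D_v f x) p.
Proof.
move=> Uo [df Cf] Up.
have [ddu cu] := Cf u; have [ddv cv] := Cf v.
have cuv := cu v p Up; have cvu := cv u p Up.
apply/eqP; rewrite -subr_eq0 -normr_eq0 eq_le normr_ge0 andbT.
apply/ler_addgt0Pl => _ /posnumP[e]; rewrite addr0.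
pose P x := U x /\
  `|'D_v (fun x => 'D_u f x) p - 'D_v (fun x => 'D_u f x) x| < e%:num / 2 /\
  `|'D_u (fun x => 'D_v f x) p - 'D_u (fun x => 'D_v f x) x| < e%:num / 2.
have e2 : 0 < e%:num / 2 :> R by [].
have h1 := (@cvgrPdist_lt _ _ _ _ _ _ _).1 cuv _ e2.
have h2 := (@cvgrPdist_lt _ _ _ _ _ _ _).1 cvu _ e2.
have : \forall x \near p, P x.
  apply: filterI; first exact: open_nbhs_nbhs.
  by apply: filterI; [exact: h1|exact: h2].
move=> /nbhs_ballP[d /= d0 dP].
have n0 : 0 < `|u| + `|v| + 1 by rewrite ltr_wpDl // addr_ge0.
(* This keeps the whole parallelogram within distance d/2 of [p]; the summand 1 makes the
   denominator positive even if [u] and [v] vanish. *)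
pose h := d / 2 / (`|u| + `|v| + 1).
have h0 : 0 < h by rewrite !divr_gt0.
have hP s t : 0 <= s <= h -> 0 <= t <= h -> P (p + s *: u + t *: v).
  move=> /andP[s0 sh] /andP[t0 th]; apply: dP.
  rewrite -ball_normE /= -addrA opprD addNKr normrN.
  apply: le_lt_trans (ler_normD _ _) _; rewrite !normrZ !ger0_norm //.
  apply: (@le_lt_trans _ _ (h * (`|u| + `|v| + 1))).
    rewrite !mulrDr mulr1 -[leLHS]addr0; apply: lerD; last exact: ltW.
    by apply: lerD; exact: ler_wpM2r.
  by rewrite divfK ?gt_eqF // ltr_pdivrMr // ltr_pMr // ltr1n.
have hU s t (sh : 0 <= s <= h) (th : 0 <= t <= h) := (hP s t sh th).1.
have hU' s t (sh : 0 <= s <= h) (th : 0 <= t <= h) : U (p + s *: v + t *: u).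
  by rewrite addrAC; exact: hU.
have [s [t [sh th e1]]] := second_difference h0 hU df ddu.
have [t' [s' [th' sh' e3]]] := second_difference h0 hU' df ddv.
have [_ [A _]] := hP s t sh th; have [_ [_ B]] := hP _ _ sh' th'.
(* Exchanging [u] and [v] only swaps the two middle corners of the second difference. *)
have gen (a1 a2 a3 a4 : R) : a1 - a2 - (a3 - a4) = a1 - a3 - (a2 - a4) by ring.
move: e3; rewrite [p + t' *: v + _]addrAC [p + h *: v + _]addrAC => e3.
have E : 'D_v (fun x => 'D_u f x) (p + s *: u + t *: v)
       = 'D_u (fun x => 'D_v f x) (p + s' *: u + t' *: v).
  apply: (@mulfI _ (h ^+ 2)); first by rewrite expf_eq0 /= gt_eqF.
  exact: etrans (esym e1) (etrans (gen _ _ _ _) e3).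
rewrite E in A.
apply: ltW; apply: le_lt_trans (ler_distD _ _ _) _; rewrite [ltRHS]splitr.
by apply: ltrD; [exact: A|rewrite distrC; exact: B].
Qed.

End Schwarz.

(** * Derivatives along vector fields and their commutators *)

Section Fields.
Context {R : realType} {V : normedModType R} {I : finType}.
Variables (b : I -> V) (c : I -> {linear V -> R}).
Hypotheses (cc : forall i, continuous (c i))
  (bc : forall v, v = \sum_i c i v *: b i).
Variables (U : set V) (Uo : open U) (f : V -> R) (fs : smooth_on U f).

Lemma derive_coord (h : V -> R) x v :
  differentiable h x -> 'D_v h x = \sum_i c i v * 'D_(b i) h x.
Proof.
move=> dh; rewrite deriveE // [in LHS](bc v) linear_sum.
by apply: eq_bigr => i _; rewrite linearZ deriveE.
Qed.

(** [Ck] speaks of fixed directions only. Expanding the varying direction in the basis turns the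
    derivative into a finite sum of coordinates of [X] times derivatives along the [b i]. *)
Lemma Ck_derive_along (X : V -> V) k :
  Ck k U X -> Ck k U (fun x => 'D_(X x) f x).
Proof.
move=> CX.
have C : Ck k U (fun x => \sum_i ((c i \o X) * (fun x => 'D_(b i) f x)) x).
  apply: Ck_sum => // i; apply: CkM => //.
    by apply: Ck_linear_comp => //; exact: cc.
  exact: smooth_onD.
apply: Ck_eq C => // x Ux.
by rewrite derive_coord //; exact: smooth_on_diff fs Ux.
Qed.

(** The product rule in the basis, proved in [key] for an arbitrary field and used for [X] and for
    the constant field with value [X p]: the two results differ exactly by the terms in which [X] is
    differentiated. *)
Lemma derive_derive_along (X : V -> V) p u : U p -> differentiable X p ->
  'D_u (fun x => 'D_(X x) f x) p =
  'D_('D_u X p) f p + 'D_u (fun x => 'D_(X p) f x) p.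
Proof.
move=> Up dX.
have df x : U x -> differentiable f x by exact: smooth_on_diff fs.
have ddf v : differentiable (fun x => 'D_v f x) p.
  by apply: smooth_on_diff Up; exact: smooth_onD.
have key (Y : V -> V) : differentiable Y p ->
    is_derive p u (fun x => 'D_(Y x) f x)
      (\sum_i (c i ('D_u Y p) * 'D_(b i) f p
             + c i (Y p) * 'D_u (fun x => 'D_(b i) f x) p)).
  move=> dY.
  have dcY i : is_derive p u (c i \o Y) (c i ('D_u Y p)).
    exact: is_derive_linear_comp u (@cc i) dY.
  have dD i : is_derive p u (fun x => 'D_(b i) f x)
      ('D_u (fun x => 'D_(b i) f x) p).
    by apply: derivableP; exact: diff_derivable.
  apply: (@near_eq_is_derive _ _ _
    (fun x => \sum_i ((c i \o Y) * (fun x => 'D_(b i) f x)) x)).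
    by apply: (near_open Uo Up) => x Ux; rewrite (derive_coord _ (df x Ux)).
  elim: (index_enum I) => [|i r IH].
    rewrite big_nil (_ : (fun _ => _) = cst 0); first exact: is_derive_cst.
    by apply/funext => x; rewrite big_nil.
  rewrite big_cons (_ : (fun _ => _) = (c i \o Y) * (fun x => 'D_(b i) f x) +
    (fun x => \sum_(j <- r) ((c j \o Y) * (fun x => 'D_(b j) f x)) x)); last first.
    by apply/funext => x; rewrite big_cons.
  apply: is_deriveD IH; apply: is_derive_eq.
  by rewrite addrC; congr (_ + _); rewrite -[LHS]/(_ * _) mulrC.
have [_ ->] := key X dX.
have [_ ->] := key (cst (X p)) (differentiable_cst _ _).
rewrite (derive_coord _ (df p Up)) -big_split /=; apply: eq_bigr => i _.
by rewrite derive_cst linear0 mul0r add0r.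
Qed.

(** The second-order terms are mixed derivatives in the fixed directions [X p] and [Y p], which
    cancel by [derive_comm]; what is left is the derivative along the bracket. *)
Lemma derive_along_commutator (X Y : V -> V) p : U p ->
  differentiable X p -> differentiable Y p ->
  'D_(X p) (fun x => 'D_(Y x) f x) p - 'D_(Y p) (fun x => 'D_(X x) f x) p
  = 'D_('D_(X p) Y p - 'D_(Y p) X p) f p.
Proof.
move=> Up dX dY; rewrite (derive_derive_along _ Up dY) (derive_derive_along _ Up dX).
have df : differentiable f p by exact: smooth_on_diff fs Up.
rewrite (derive_comm (X p) (Y p) Uo (fs 2) Up).
rewrite [RHS]deriveE // linearB /= -!deriveE //.
have cancel (x y z : R) : x + z - (y + z) = x - y by ring.
exact: cancel.
Qed.

End Fields.

(** * Coordinates on the model space of the tangent bundle *)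

Section Coordinates.
Context {R : realType} {n : nat}.
Notation E := 'rV[R]_n.
Notation V := (E * E)%type.

Definition xcoord (i : 'I_n) (w : V) : R := w.1 0 i.
Definition ycoord (i : 'I_n) (w : V) : R := w.2 0 i.

Fact xcoord_linear i : linear (xcoord i : V -> R^o).
Proof. by move=> a u v; rewrite /xcoord /= !mxE. Qed.
Fact ycoord_linear i : linear (ycoord i : V -> R^o).
Proof. by move=> a u v; rewrite /ycoord /= !mxE. Qed.

HB.instance Definition _ i :=
  GRing.isLinear.Build R V R^o *:%R (xcoord i) (xcoord_linear i).
HB.instance Definition _ i :=
  GRing.isLinear.Build R V R^o *:%R (ycoord i) (ycoord_linear i).

Lemma xcoord_continuous i : continuous (xcoord i).
Proof.
move=> w; apply: (@continuous_comp _ _ _ fst (fun x : E => x 0 i)).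
  exact: cvg_fst.
exact: coord_continuous.
Qed.

Lemma ycoord_continuous i : continuous (ycoord i).
Proof.
move=> w; apply: (@continuous_comp _ _ _ snd (fun x : E => x 0 i)).
  exact: cvg_snd.
exact: coord_continuous.
Qed.

(** With [pair_basis], this is the finite dual pair of bases on which the results about derivatives
    along fields rest. *)
Definition pair_coord (i : 'I_n + 'I_n) : {linear V -> R} :=
  match i with inl i => xcoord i | inr i => ycoord i end.

Definition pair_basis (i : 'I_n + 'I_n) : V :=
  match i with inl i => (delta_mx 0 i, 0) | inr i => (0, delta_mx 0 i) end.

Lemma pair_coord_continuous i : continuous (pair_coord i).
Proof. by case: i => i; [exact: xcoord_continuous|exact: ycoord_continuous]. Qed.

Lemma pair_basisP v : v = \sum_i pair_coord i v *: pair_basis i.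
Proof.
rewrite big_sumType /=; case: v => x y.
have e1 : \sum_i xcoord i (x, y) *: ((delta_mx 0 i, 0) : V) = (x, 0).
  rewrite {2}(row_sum_delta x).
  elim/big_rec2: _ => // i u v _ ->.
  by apply: (congr2 pair); rewrite //= scaler0 addr0.
have e2 : \sum_i ycoord i (x, y) *: ((0, delta_mx 0 i) : V) = (0, y).
  rewrite {2}(row_sum_delta y).
  elim/big_rec2: _ => // i u v _ ->.
  by apply: (congr2 pair); rewrite //= scaler0 addr0.
by rewrite e1 e2; apply: (congr2 pair); rewrite /= ?addr0 ?add0r.
Qed.

Lemma is_derive_xcoord i (w v : V) : is_derive w v (xcoord i) (xcoord i v).
Proof.
have d : differentiable (xcoord i) w.
  by apply: linear_differentiable; exact: xcoord_continuous.
apply: DeriveDef; first exact: diff_derivable.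
by rewrite deriveE // diff_lin //; exact: xcoord_continuous.
Qed.

Lemma is_derive_ycoord i (w v : V) : is_derive w v (ycoord i) (ycoord i v).
Proof.
have d : differentiable (ycoord i) w.
  by apply: linear_differentiable; exact: ycoord_continuous.
apply: DeriveDef; first exact: diff_derivable.
by rewrite deriveE // diff_lin //; exact: ycoord_continuous.
Qed.

End Coordinates.

(** * C^k maps with values in row vectors *)

Section RowValued.
Context {R : realType} {V : normedModType R} {n : nat}.
Variables (U : set V) (Uo : open U).

Lemma Ck_entry (f : V -> 'rV[R]_n) j k :
  Ck k U f -> Ck k U (fun x => f x 0 j).
Proof.
move=> Cf.
have @L : {linear 'rV[R]_n -> R}.
  by exists (fun N : 'rV[R]_n => N 0 j); do 2![eexists]; do ?[constructor];
     rewrite ?mxE// => ? *; rewrite ?mxE//; move=> ?; rewrite !mxE.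
by apply: (Ck_linear_comp Uo (L := L)) => //; exact: coord_continuous.
Qed.

Lemma Ck_comb {W : normedModType R} {I : finType} (b : I -> W)
    (g : I -> V -> R) k :
  (forall i, Ck k U (g i)) -> Ck k U (fun x => \sum_i g i x *: b i).
Proof.
move=> Cg; apply: Ck_sum => // i.
pose h (r : R^o) : W := r *: b i.
have hl : linear h by move=> a u v; rewrite /h scalerDl -scalerA.
pose L : {linear R^o -> W} := HB.pack h (GRing.isLinear.Build _ _ _ _ h hl).
by apply: (Ck_linear_comp Uo (L := L)) => //; exact: scalel_continuous.
Qed.

Lemma Ck_row (f : V -> 'rV[R]_n) k :
  (forall j, Ck k U (fun x => f x 0 j)) -> Ck k U f.
Proof.
move=> Cf; have C := Ck_comb (fun j : 'I_n => delta_mx 0 j : 'rV[R]_n) Cf.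
by apply: (Ck_eq Uo _ C) => x _; rewrite -row_sum_delta.
Qed.

Lemma Ck_pair (f g : V -> 'rV[R]_n) k :
  (forall j, Ck k U (fun x => f x 0 j)) -> (forall j, Ck k U (fun x => g x 0 j)) ->
  Ck k U (fun x => (f x, g x)).
Proof.
move=> Cf Cg.
have Cfg i : Ck k U (fun x => pair_coord i (f x, g x)).
  by case: i => i; [exact: Cf|exact: Cg].
have C := Ck_comb pair_basis Cfg.
by apply: (Ck_eq Uo _ C) => x _; rewrite -pair_basisP.
Qed.

End RowValued.

(** * The metric and the connection form as algebra in the frame e_k *)

Definition o0 : 'I_3 := @Ordinal 3 0 isT.
Definition o1 : 'I_3 := @Ordinal 3 1 isT.
Definition o2 : 'I_3 := @Ordinal 3 2 isT.

Lemma ord3_ind (P : 'I_3 -> Prop) : P o0 -> P o1 -> P o2 -> forall k, P k.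
Proof.
move=> P0 P1 P2 [[|[|[|//]]] lt].
- by rewrite (_ : Ordinal lt = o0) //; exact: val_inj.
- by rewrite (_ : Ordinal lt = o1) //; exact: val_inj.
- by rewrite (_ : Ordinal lt = o2) //; exact: val_inj.
Qed.

Section Algebra.
Context {R : comNzRingType}.
Implicit Types f h t : 'I_3 -> R.

Definition wsum f : R := f o0 + f o1 - f o2.

(* [F ^+ 2 * gform] is the Finsler metric in the frame e_k = y_k d/dy_k. *)
Definition gform f h : R :=
  2 * wsum f * wsum h - wsum (fun k => f k * h k).

(* The derivative of the section with constant components [f] along a vector
   on which the coframe [theta] below takes the values [t]: this is the
   Levi-Civita connection of e^(2 s) G with s = log y_1 + log y_2 - log y_3. *)
Definition cform f t (l : 'I_3) : R :=
  wsum f * t l + wsum t * f l - gform f t.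

(** Metric compatibility: along a vector with coframe values [t] the logarithmic derivative of F^2
    is 2 [wsum t], and the connection form has to account for exactly this. *)
Lemma gform_cform f h t :
  gform (cform f t) h + gform f (cform h t) = 2 * wsum t * gform f h.
Proof. rewrite /gform /cform /gform /wsum; ring. Qed.

(** The symmetry required of the (h)hv-torsion. The product [f k * t k] is subtracted because the
    e_k themselves vary along the fibres. *)
Lemma gform_cform_sym f h t :
  gform (fun k => cform f t k - f k * t k) h =
  gform (fun k => cform h t k - h k * t k) f.
Proof. rewrite /gform /cform /gform /wsum; ring. Qed.

(** The field [eta] is e_1 + e_2 + e_3, so this makes the coframe the components of K. *)
Lemma cform1 t l : cform (fun=> 1) t l = t l.
Proof. rewrite /cform /gform /wsum; ring. Qed.

Lemma cform0 f l : cform f (fun=> 0) l = 0.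
Proof. rewrite /cform /gform /wsum; ring. Qed.

(** Testing against the constant 1 gives [wsum f] = 0; the form then reduces to its diagonal part,
    and the unit vectors isolate each component up to sign. *)
Lemma gform_nondegenerate f : (forall h, gform f h = 0) -> forall k, f k = 0.
Proof.
move=> f0.
have g0 k0 := f0 (fun k => (k == k0)%:R).
have s := f0 (fun=> 1).
have e : wsum f = 0 by rewrite -[RHS]s /gform /wsum; ring.
apply: ord3_ind.
- have := g0 o0; rewrite /gform e /wsum /= => h; rewrite -[RHS]oppr0.
  by rewrite -[X in - X]h; ring.
- have := g0 o1; rewrite /gform e /wsum /= => h; rewrite -[RHS]oppr0.
  by rewrite -[X in - X]h; ring.
- by have := g0 o2; rewrite /gform e /wsum /= => h; rewrite -[RHS]h; ring.
Qed.

End Algebra.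

(** * The metric function and the connection in the model R^3 x R^3 *)

Section Connection.
Context {R : realType}.
Notation E := 'rV[R]_3.
Notation V := (E * E)%type.

Definition cone : set V := [set w | forall k, 0 < ycoord k w].

Lemma cone_open : open cone.
Proof.
have -> : cone = (ycoord o0 @^-1` [set r | 0 < r]) `&`
   ((ycoord o1 @^-1` [set r | 0 < r]) `&` (ycoord o2 @^-1` [set r | 0 < r])).
  apply/seteqP; split=> w /=; first by move=> h; split; [|split]; exact: h.
  by move=> [h0 [h1 h2]]; apply: ord3_ind.
by do ![apply: openI]; apply: open_comp => [w _|];
  (exact: open_gt || exact: ycoord_continuous).
Qed.

Lemma cone_neq0 w k : cone w -> ycoord k w != 0.
Proof. by move=> cw; rewrite gt_eqF. Qed.

(** The partial derivatives of x_1 x_2, chosen so that theta_1 + theta_2 - theta_3 = d log F. *)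
Definition acoef (k : 'I_3) (w : V) : R :=
  match val k with 0 => xcoord o1 w | 1 => xcoord o0 w | _ => 0 end.

(* theta_k = dy_k / y_k + a_k dx_k, normalized by theta_k (e_j) = delta_kj on
   vertical vectors and by vanishing on horizontal ones. *)
Definition theta (w X : V) (k : 'I_3) : R :=
  ycoord k X / ycoord k w + acoef k w * xcoord k X.

(** The component of [Y] along e_k. *)
Definition fcoord (Y : V -> E) (k : 'I_3) (w : V) : R := Y w 0 k / ycoord k w.

(* The components with respect to the frame e_k are differentiated, so that the
   e_k are horizontally parallel. *)
Definition conn (w X : V) (Y : V -> E) : E :=
  \row_l (ycoord l w * ('D_X (fcoord Y l) w +
                     cform (fcoord Y ^~ w) (theta w X) l)).

Definition Floc (w : V) : R :=
  expR (xcoord o0 w * xcoord o1 w) *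
  (ycoord o0 w * ycoord o1 w / ycoord o2 w).

Section Smoothness.
Variable k : nat.

Lemma Ck_xcoord i : Ck k cone (@xcoord R 3 i).
Proof. by apply: (Ck_linear cone_open); exact: xcoord_continuous. Qed.

Lemma Ck_ycoord i : Ck k cone (@ycoord R 3 i).
Proof. by apply: (Ck_linear cone_open); exact: ycoord_continuous. Qed.

Lemma Ck_ycoordV i : Ck k cone (fun w => (@ycoord R 3 i w)^-1).
Proof. by apply: (CkV cone_open) (Ck_ycoord i) => w cw; exact: cone_neq0. Qed.

Lemma Ck_acoef i : Ck k cone (acoef i).
Proof.
case: i => [[|[|i]] lt]; [exact: Ck_xcoord|exact: Ck_xcoord|].
exact: (Ck_cst cone_open).
Qed.

Lemma Ck_fcoord (Y : V -> E) l : Ck k cone Y -> Ck k cone (fcoord Y l).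
Proof.
move=> CY; apply: (CkM cone_open); last exact: Ck_ycoordV.
exact: (Ck_entry cone_open).
Qed.

Lemma Ck_theta (X : V -> V) l :
  Ck k cone X -> Ck k cone (fun w => theta w (X w) l).
Proof.
move=> CX; apply: (CkD cone_open); apply: (CkM cone_open).
- by apply: (Ck_linear_comp cone_open) CX; exact: ycoord_continuous.
- exact: Ck_ycoordV.
- exact: Ck_acoef.
- by apply: (Ck_linear_comp cone_open) CX; exact: xcoord_continuous.
Qed.

Lemma Ck_wsum (f : 'I_3 -> V -> R) :
  (forall i, Ck k cone (f i)) -> Ck k cone (fun w => wsum (f ^~ w)).
Proof.
by move=> Cf; apply: (CkB cone_open) => //; exact: (CkD cone_open).
Qed.

Lemma Ck_gform (f h : 'I_3 -> V -> R) :
  (forall i, Ck k cone (f i)) -> (forall i, Ck k cone (h i)) ->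
  Ck k cone (fun w => gform (f ^~ w) (h ^~ w)).
Proof.
move=> Cf Ch; apply: (CkB cone_open).
  apply: (CkM cone_open); last exact: Ck_wsum.
  by apply: (CkM cone_open); [exact: (Ck_cst cone_open (2 : R))|exact: Ck_wsum].
by apply: (Ck_wsum (f := fun i w => f i w * h i w)) => i; exact: (CkM cone_open).
Qed.

End Smoothness.

Lemma Floc_smooth : smooth_on cone Floc.
Proof.
move=> k; apply: (CkM cone_open).
  by apply: (Ck_expR cone_open); apply: (CkM cone_open); exact: Ck_xcoord.
apply: (CkM cone_open); last exact: Ck_ycoordV.
by apply: (CkM cone_open); exact: Ck_ycoord.
Qed.

Lemma conn_smooth (X : V -> V) (Y : V -> E) :
  smooth_on cone X -> smooth_on cone Y ->
  smooth_on cone (fun w => conn w (X w) Y).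
Proof.
move=> sX sY k; apply: (Ck_row cone_open) => l.
have sC i : smooth_on cone (fcoord Y i) by move=> m; exact: Ck_fcoord.
have C : Ck k cone (fun w => ycoord l w * ('D_(X w) (fcoord Y l) w +
    cform (fcoord Y ^~ w) (theta w (X w)) l)).
  apply: (CkM cone_open); first exact: Ck_ycoord.
  apply: (CkD cone_open).
    exact: (Ck_derive_along pair_coord_continuous pair_basisP cone_open (sC l) (sX k)).
  apply: (CkB cone_open).
    by apply: (CkD cone_open); apply: (CkM cone_open); do ?[exact: Ck_theta|exact: sC];
      apply: Ck_wsum => i; [exact: sC|exact: Ck_theta].
  by apply: (Ck_gform (h := fun i w => theta w (X w) i)) => i;
    [exact: sC|exact: Ck_theta].
by apply: (Ck_eq cone_open) C => w _; rewrite mxE.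
Qed.

End Connection.

(** * Derivatives of F and the curvature on horizontal fields *)

Section HorizontalCurvature.
Context {R : realType}.
Notation E := 'rV[R]_3.
Notation V := (E * E)%type.
Implicit Types w X : V.

Lemma cone_near (P : V -> Prop) w :
  cone w -> (forall y, cone y -> P y) -> \near w, P w.
Proof. by move=> cw h; exact: (near_open cone_open cw h). Qed.

Lemma is_derive_mulf (f g : V -> R) w X df dg : is_derive w X f df ->
  is_derive w X g dg -> is_derive w X (fun y => f y * g y) (f w * dg + g w * df).
Proof. by move=> hf hg; exact: is_deriveM. Qed.

Lemma is_derive_addf (f g : V -> R) w X df dg : is_derive w X f df ->
  is_derive w X g dg -> is_derive w X (fun y => f y + g y) (df + dg).
Proof. by move=> hf hg; exact: is_deriveD. Qed.

Lemma is_derive_subf (f g : V -> R) w X df dg : is_derive w X f df ->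
  is_derive w X g dg -> is_derive w X (fun y => f y - g y) (df - dg).
Proof. by move=> hf hg; exact: is_deriveB. Qed.

Lemma is_derive_divf (f g : V -> R) w X df dg : g w != 0 ->
  is_derive w X f df -> is_derive w X g dg ->
  is_derive w X (fun y => f y / g y) (df / g w - f w * dg / g w ^+ 2).
Proof.
move=> gw hf [ex_g <-].
have hg : is_derive w X (fun y => (g y)^-1) (- (g w) ^- 2 * 'D_X g w).
  by split; [exact: derivableV|rewrite deriveV].
apply: is_derive_eq (is_derive_mulf hf hg) _; field; exact: gw.
Qed.

(** Here log F = x_1 x_2 + log y_1 + log y_2 - log y_3, whose differential is theta_1 + theta_2 -
    theta_3. In particular F is constant along horizontal vectors. *)
Lemma Floc_derive w X : cone w -> is_derive w X Floc (Floc w * wsum (theta w X)).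
Proof.
move=> cw; have y0 k : ycoord k w != 0 by exact: cone_neq0.
have dx k := is_derive_xcoord k w X; have dy k := is_derive_ycoord k w X.
have dxx := is_derive_mulf (dx o0) (dx o1).
have de : is_derive w X (fun w => expR (xcoord o0 w * xcoord o1 w))
    (expR (xcoord o0 w * xcoord o1 w) *
     (xcoord o0 w * xcoord o1 X + xcoord o1 w * xcoord o0 X)).
  have [] := @derive_expR_comp _ _ (fun w => xcoord o0 w * xcoord o1 w) w X.
    apply: (@differentiableM _ _ (xcoord o0) (xcoord o1));
    apply: linear_differentiable; exact: xcoord_continuous.
  move=> d1 d2; split; first exact: diff_derivable.
  by rewrite [LHS]d2 derive_val.
have dq := is_derive_divf (y0 o2) (is_derive_mulf (dy o0) (dy o1)) (dy o2).
apply: is_derive_eq (is_derive_mulf de dq) _.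
rewrite /wsum /theta /Floc /acoef /=; field.
by rewrite !y0.
Qed.

Lemma Floc_gt0 w : cone w -> 0 < Floc w.
Proof.
by move=> cw; rewrite mulr_gt0 ?expR_gt0 // divr_gt0 ?mulr_gt0 ?cw.
Qed.

(** By [Floc_derive] the first vertical derivative is 2 F^2 times the [wsum] of the v_k / y_k.
    Differentiating F^2 once more gives the product term of [gform], and differentiating 1 / y_k
    gives its diagonal term. *)
Lemma Floc_hessian w (u v : E) : cone w ->
  2^-1 * 'D_(0, u) (fun a : V => 'D_(0, v) (fun b => Floc b ^+ 2) a) w =
  Floc w ^+ 2 * gform (fun k => u 0 k / ycoord k w) (fun k => v 0 k / ycoord k w).
Proof.
move=> cw; have y0 k : ycoord k w != 0 by exact: cone_neq0.
have x0 k : xcoord k ((0, u) : V) = 0 by rewrite /xcoord mxE.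
have x0' k : xcoord k ((0, v) : V) = 0 by rewrite /xcoord mxE.
have d1 a : cone a -> 'D_(0, v) (fun b => Floc b ^+ 2) a =
    2 * (Floc a * Floc a * wsum (fun k => v 0 k / ycoord k a)).
  move=> ca; have dF := Floc_derive (0, v) ca.
  have [_ e] := is_derive_mulf dF dF.
  rewrite -[LHS]/('D_(0, v) (fun b => Floc b * Floc b) a) e.
  by rewrite /wsum /theta !x0' /ycoord /=; ring.
rewrite (near_eq_derive _ (cone_near cw d1)).
have dF := Floc_derive (0, u) cw.
have dy k := is_derive_ycoord k w (0, u).
have dc k := is_derive_cst (v 0 k) w (0, u).
have dq k := is_derive_divf (y0 k) (dc k) (dy k).
have dw := is_derive_subf (is_derive_addf (dq o0) (dq o1)) (dq o2).
have [_ e] := is_derive_mulf (is_derive_cst (2 : R) w (0, u))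
  (is_derive_mulf (is_derive_mulf dF dF) dw).
rewrite [X in _ * X]e /gform /wsum /theta !x0 /ycoord /cst /=; field.
by rewrite -!/(ycoord _ _) !y0.
Qed.

Lemma fcoord_conn (X : V -> V) (Y : V -> E) l w : cone w ->
  fcoord (fun w => conn w (X w) Y) l w =
  'D_(X w) (fcoord Y l) w + cform (fcoord Y ^~ w) (theta w (X w)) l.
Proof.
by move=> cw; rewrite {1}/fcoord mxE mulrC mulKf //; exact: cone_neq0.
Qed.

Lemma theta_linear w (a : R) X X' k :
  theta w (a *: X + X') k = a * theta w X k + theta w X' k.
Proof. rewrite /theta !linearP /=; rewrite -![_ *: _]/(_ * _); ring. Qed.

(** The identity theta_k(X) = 0 holds on all of [cone]; differentiating it along [u] moves the
    derivative from [X] to the coefficients of theta_k. *)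
Lemma theta_derive_horizontal (X : V -> V) w (u : V) k : cone w ->
  differentiable X w -> (forall y, cone y -> theta y (X y) k = 0) ->
  theta w ('D_u X w) k =
  ycoord k (X w) * ycoord k u / ycoord k w ^+ 2
  - 'D_u (acoef k) w * xcoord k (X w).
Proof.
move=> cw dX hX.
have dy := is_derive_linear_comp u (@ycoord_continuous R 3 k) dX.
have dx := is_derive_linear_comp u (@xcoord_continuous R 3 k) dX.
have da : is_derive w u (acoef k) ('D_u (acoef k) w).
  by apply: derivableP; apply: diff_derivable;
    exact: (smooth_on_diff (fun n => Ck_acoef n k) cw).
have y0 : ycoord k w != 0 by exact: cone_neq0.
have dth := is_derive_addf (is_derive_divf y0 dy (is_derive_ycoord k w u))
  (is_derive_mulf da dx).
have [_ e] := dth; move: e; rewrite (near_eq_derive _ (cone_near cw hX)).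
rewrite derive_cst => /esym/eqP e.
apply/eqP; rewrite -subr_eq0 -(eqP e) /theta; apply/eqP; field; exact: y0.
Qed.

Lemma derive_acoef w u k : 'D_u (acoef k) w =
  match val k with 0 => xcoord o1 u | 1 => xcoord o0 u | _ => 0 end.
Proof.
elim/ord3_ind: k => /=.
- by have [_] := is_derive_xcoord o1 w u.
- by have [_] := is_derive_xcoord o0 w u.
- by rewrite (_ : acoef o2 = cst 0) ?derive_cst.
Qed.

(* The values of - d theta_k on the horizontal lifts of x and y. *)
Definition twist (x y : E) (k : 'I_3) : R :=
  match val k with
  | 0 => x 0 o0 * y 0 o1 - x 0 o1 * y 0 o0
  | 1 => - (x 0 o0 * y 0 o1 - x 0 o1 * y 0 o0)
  | _ => 0
  end.

(** For horizontal fields theta([X, Y]) = - d theta(X, Y). The contributions of dy_k / y_k are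
    symmetric in [X] and [Y] and cancel, so only the derivatives of [acoef] remain. *)
Lemma theta_bracket (X Y : V -> V) w : cone w ->
  differentiable X w -> differentiable Y w ->
  (forall y, cone y -> forall k, theta y (X y) k = 0) ->
  (forall y, cone y -> forall k, theta y (Y y) k = 0) ->
  theta w ('D_(X w) Y w - 'D_(Y w) X w) =1 twist (X w).1 (Y w).1.
Proof.
move=> cw dX dY hX hY k.
rewrite addrC -scaleN1r theta_linear.
have eX := theta_derive_horizontal (Y w) cw dX (fun y cy => hX y cy k).
have eY := theta_derive_horizontal (X w) cw dY (fun y cy => hY y cy k).
rewrite [X in -1 * X + _]eX [X in _ + X]eY.
rewrite !derive_acoef /twist /xcoord {eX eY}.
by elim/ord3_ind: k => /=; ring.
Qed.

(** On horizontal vectors [conn] merely differentiates frame components. The commutator of the first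
    two terms therefore cancels the derivative part of the third, leaving minus the connection form
    on theta([X, Y]), which is [twist]. *)
Lemma conn_curvature (X Y : V -> V) (Z : V -> E) w : cone w ->
  smooth_on cone X -> smooth_on cone Y -> smooth_on cone Z ->
  (forall y, cone y -> forall k, theta y (X y) k = 0) ->
  (forall y, cone y -> forall k, theta y (Y y) k = 0) ->
  conn w (X w) (fun y => conn y (Y y) Z) - conn w (Y w) (fun y => conn y (X y) Z)
  - conn w ('D_(X w) Y w - 'D_(Y w) X w) Z =
  - \row_l (ycoord l w * cform (fcoord Z ^~ w) (twist (X w).1 (Y w).1) l).
Proof.
move=> cw sX sY sZ hX hY.
have key (A B : V -> V) l : (forall y, cone y -> forall k, theta y (A y) k = 0) ->
    (forall y, cone y -> forall k, theta y (B y) k = 0) ->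
    conn w (A w) (fun y => conn y (B y) Z) 0 l =
    ycoord l w * 'D_(A w) (fun y => 'D_(B y) (fcoord Z l) y) w.
  move=> hA hB; rewrite mxE.
  rewrite (_ : theta w (A w) = fun=> 0); last by apply/funext => k; exact: hA.
  rewrite cform0 addr0; congr (_ * _); apply: near_eq_derive.
  apply: (cone_near cw) => y cy; rewrite fcoord_conn //.
  rewrite (_ : theta y (B y) = fun=> 0); last by apply/funext => k; exact: hB.
  by rewrite cform0 addr0.
have dX := smooth_on_diff sX cw; have dY := smooth_on_diff sY cw.
have dC l : smooth_on cone (fcoord Z l) by move=> n; exact: Ck_fcoord.
rewrite -(funext (theta_bracket cw dX dY hX hY)).
apply/rowP => l.
transitivity (ycoord l w * ('D_(X w) (fun y => 'D_(Y y) (fcoord Z l) y) w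
    - 'D_(Y w) (fun y => 'D_(X y) (fcoord Z l) y) w
    - ('D_('D_(X w) Y w - 'D_(Y w) X w) (fcoord Z l) w
       + cform (fcoord Z ^~ w) (theta w ('D_(X w) Y w - 'D_(Y w) X w)) l))).
  have sub3 (u v c : E) : (u - v - c) 0 l = u 0 l - v 0 l - c 0 l.
    by rewrite !mxE.
  rewrite sub3 [X in X - _ - _](key X Y) // [X in _ - X - _](key Y X) //.
  by rewrite [X in _ - X]mxE !mulrBr.
have c := derive_along_commutator pair_coord_continuous pair_basisP cone_open
  (dC l) cw dX dY.
rewrite [X in _ * (X - _)]c.
by rewrite !mxE opprD addNKr mulrN.
Qed.

End HorizontalCurvature.

(** * The axioms of the Cartan connection in the model *)

Section CartanAxioms.
Context {R : realType}.
Notation E := 'rV[R]_3.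
Notation V := (E * E)%type.
Implicit Types w X : V.

Lemma derive_fcoord (Y : V -> E) w X l : cone w -> smooth_on cone Y ->
  'D_X (fcoord Y l) w =
  'D_X (fun y => Y y 0 l) w / ycoord l w - Y w 0 l * ycoord l X / ycoord l w ^+ 2.
Proof.
move=> cw sY; have y0 := cone_neq0 l cw.
have dY : is_derive w X (fun y => Y y 0 l) ('D_X (fun y => Y y 0 l) w).
  apply: derivableP; apply: diff_derivable.
  by apply: (smooth_on_diff _ cw) => k; exact: (Ck_entry cone_open).
by have [_] := is_derive_divf y0 dY (is_derive_ycoord l w X).
Qed.

Lemma is_derive_fcoord (Y : V -> E) w X l : cone w -> smooth_on cone Y ->
  is_derive w X (fcoord Y l) ('D_X (fcoord Y l) w).
Proof.
move=> cw sY; apply: derivableP; apply: diff_derivable.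
by apply: (smooth_on_diff _ cw) => k; exact: Ck_fcoord.
Qed.

Lemma conn_eq (Y Y' : V -> E) w X :
  cone w -> (forall y, cone y -> Y y = Y' y) -> conn w X Y = conn w X Y'.
Proof.
move=> cw YY'; apply/rowP => l; rewrite !mxE; congr (_ * (_ + cform _ _ _)).
  by apply/near_eq_derive/(cone_near cw) => y cy; rewrite /fcoord YY'.
by apply/funext => k; rewrite /fcoord YY'.
Qed.

Lemma conn_linear_model (Y : V -> E) w (a : R) X X' :
  cone w -> smooth_on cone Y ->
  conn w (a *: X + X') Y = a *: conn w X Y + conn w X' Y.
Proof.
move=> cw sY; apply/rowP => l; rewrite !mxE.
have d : differentiable (fcoord Y l) w.
  by apply: (smooth_on_diff _ cw) => k; exact: Ck_fcoord.
rewrite !deriveE // linearP /= /cform /gform /wsum !theta_linear.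
rewrite -[_ *: _]/(_ * _); ring.
Qed.

Lemma conn_add_model (Y Y' : V -> E) w X :
  cone w -> smooth_on cone Y -> smooth_on cone Y' ->
  conn w X (fun y => Y y + Y' y) = conn w X Y + conn w X Y'.
Proof.
move=> cw sY sY'; apply/rowP => l; rewrite !mxE.
have e k : fcoord (fun y => Y y + Y' y) k = (fun y => fcoord Y k y + fcoord Y' k y).
  by apply/funext => y; rewrite /fcoord mxE mulrDl.
have [_] := is_derive_addf (is_derive_fcoord X l cw sY) (is_derive_fcoord X l cw sY').
rewrite -e => ->; rewrite /cform /gform /wsum !e; ring.
Qed.

Lemma conn_leibniz_model (g : V -> R) (Y : V -> E) w X :
  cone w -> smooth_on cone g -> smooth_on cone Y ->
  conn w X (fun y => g y *: Y y) = 'D_X g w *: Y w + g w *: conn w X Y.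
Proof.
move=> cw sg sY; apply/rowP => l; rewrite !mxE.
have e k : fcoord (fun y => g y *: Y y) k = (fun y => g y * fcoord Y k y).
  by apply/funext => y; rewrite /fcoord mxE mulrA.
have dg : is_derive w X g ('D_X g w).
  by apply: derivableP; apply: diff_derivable; exact: smooth_on_diff cw.
have [_] := is_derive_mulf dg (is_derive_fcoord X l cw sY).
rewrite -e => ->; rewrite /cform /gform /wsum !e.
have {1}-> : Y w 0 l = ycoord l w * fcoord Y l w.
  by rewrite /fcoord mulrC divfK //; exact: cone_neq0.
ring.
Qed.

Lemma is_derive_gform (f h : 'I_3 -> V -> R) w X (df dh : 'I_3 -> R) :
  (forall k, is_derive w X (f k) (df k)) -> (forall k, is_derive w X (h k) (dh k)) ->
  is_derive w X (fun y => gform (f ^~ y) (h ^~ y))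
    (gform df (h ^~ w) + gform (f ^~ w) dh).
Proof.
move=> Df Dh.
have Dw (p : 'I_3 -> V -> R) (dp : 'I_3 -> R) :
    (forall k, is_derive w X (p k) (dp k)) ->
    is_derive w X (fun y => wsum (p ^~ y)) (wsum dp).
  by move=> Dp; exact: is_derive_subf (is_derive_addf (Dp o0) (Dp o1)) (Dp o2).
have D2 := is_derive_mulf (is_derive_cst (2 : R) w X) (Dw _ _ Df).
have Dp := Dw _ _ (fun k => is_derive_mulf (Df k) (Dh k)).
apply: is_derive_eq (is_derive_subf (is_derive_mulf D2 (Dw _ _ Dh)) Dp) _.
rewrite /gform /wsum /cst; ring.
Qed.

(** The derivatives of the components match on both sides; the derivative of F^2, given by
    [Floc_derive], is matched by the connection forms through [gform_cform]. *)
Lemma conn_metrical (Y Z : V -> E) w X : cone w ->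
  smooth_on cone Y -> smooth_on cone Z ->
  'D_X (fun y => Floc y ^+ 2 * gform (fcoord Y ^~ y) (fcoord Z ^~ y)) w =
  Floc w ^+ 2 * gform (fun k => conn w X Y 0 k / ycoord k w) (fcoord Z ^~ w) +
  Floc w ^+ 2 * gform (fcoord Y ^~ w) (fun k => conn w X Z 0 k / ycoord k w).
Proof.
move=> cw sY sZ.
have dY k := is_derive_fcoord X k cw sY; have dZ k := is_derive_fcoord X k cw sZ.
have dF := Floc_derive X cw.
have [_ e] := is_derive_mulf (is_derive_mulf dF dF) (is_derive_gform dY dZ).
rewrite [LHS]e.
have ce (Y' : V -> E) k : conn w X Y' 0 k / ycoord k w =
    'D_X (fcoord Y' k) w + cform (fcoord Y' ^~ w) (theta w X) k.
  by rewrite mxE mulrC mulKf //; exact: cone_neq0.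
rewrite (funext (ce Y)) (funext (ce Z)).
set f := fcoord Y ^~ w; set h := fcoord Z ^~ w; set t := theta w X.
set df := fun k => 'D_X (fcoord Y k) w; set dh := fun k => 'D_X (fcoord Z k) w.
have eD (p q r : 'I_3 -> R) : gform (fun k => p k + q k) r = gform p r + gform q r.
  by rewrite /gform /wsum; ring.
have eDr (p q r : 'I_3 -> R) : gform r (fun k => p k + q k) = gform r p + gform r q.
  by rewrite /gform /wsum; ring.
rewrite (eD df) (eDr dh) -/f -/h.
have := gform_cform f h t.
move: (gform (cform f t) h) (gform f (cform h t)) => a b ab.
transitivity (Floc w ^+ 2 * (gform df h + gform f dh) + Floc w ^+ 2 * (a + b)).
  rewrite ab; ring.
ring.
Qed.

(** The plain derivatives cancel against the bracket. Differentiating 1 / y_l leaves a correction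
    that, once horizontality replaces dy_l by - y_l a_l dx_l, is a_l times the product of the l-th
    base components of [X] and [Y], hence symmetric. *)
Lemma conn_torsion (X Y : V -> V) w : cone w ->
  smooth_on cone X -> smooth_on cone Y ->
  (forall y, cone y -> forall k, theta y (X y) k = 0) ->
  (forall y, cone y -> forall k, theta y (Y y) k = 0) ->
  conn w (X w) (fun y => (Y y).1) - conn w (Y w) (fun y => (X y).1)
  - ('D_(X w) Y w - 'D_(Y w) X w).1 = 0.
Proof.
move=> cw sX sY hX hY.
have s1 (A : V -> V) : smooth_on cone A -> smooth_on cone (fun y => (A y).1).
  move=> sA k; apply: (Ck_row cone_open) => j.
  exact: (Ck_linear_comp cone_open (@xcoord_continuous R 3 j) (sA k)).
have y0 k := cone_neq0 k cw.
have dx (A : V -> V) u l : smooth_on cone A ->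
    ('D_u A w).1 0 l = 'D_u (fun y => (A y).1 0 l) w.
  move=> sA.
  have [_ e] := is_derive_linear_comp u (@xcoord_continuous R 3 l)
    (smooth_on_diff sA cw).
  exact: esym e.
apply/rowP => l.
have hX' := hX w cw l; have hY' := hY w cw l.
have t0 (A : V -> V) : (forall y, cone y -> forall k, theta y (A y) k = 0) ->
    theta w (A w) = fun=> 0.
  by move=> hA; apply/funext => k; exact: hA.
have cE (A : V -> V) (B : V -> E) :
    (forall y, cone y -> forall k, theta y (A y) k = 0) ->
    smooth_on cone B -> conn w (A w) B 0 l = 'D_(A w) (fun y => B y 0 l) w
      - B w 0 l * ycoord l (A w) / ycoord l w.
  move=> hA sB; rewrite mxE (t0 A hA) cform0 addr0 derive_fcoord //.
  by field; exact: y0.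
have sub4 (a b c d : E) : (a - b - (c - d)) 0 l = a 0 l - b 0 l - (c 0 l - d 0 l).
  by rewrite !mxE.
have cX := cE X _ hX (s1 Y sY); have cY := cE Y _ hY (s1 X sX).
apply: etrans (sub4 _ _ ('D_(X w) Y w).1 ('D_(Y w) X w).1) _.
rewrite [X in X - _ - _]cX [X in _ - X - _]cY.
rewrite [X in _ - (X - _)]dx // [X in _ - (_ - X)]dx //.
rewrite mxE.
have eX : ycoord l (X w) = - ycoord l w * (acoef l w * (X w).1 0 l).
  apply: (mulIf (invr_neq0 (y0 l))); apply/eqP; rewrite -subr_eq0 -hX'.
  by rewrite /theta /xcoord; apply/eqP; field; exact: y0.
have eY : ycoord l (Y w) = - ycoord l w * (acoef l w * (Y w).1 0 l).
  apply: (mulIf (invr_neq0 (y0 l))); apply/eqP; rewrite -subr_eq0 -hY'.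
  by rewrite /theta /xcoord; apply/eqP; field; exact: y0.
rewrite eX eY; field; exact: y0.
Qed.

(** The horizontal lift of [x]: the equations theta_k = 0 solved for dy_k. *)
Definition hor w (x : E) : V :=
  (x, \row_k (- ycoord k w * (acoef k w * x 0 k))).

Lemma theta_hor w x k : cone w -> theta w (hor w x) k = 0.
Proof.
move=> cw; rewrite /theta /hor /ycoord /xcoord /= mxE -/(ycoord _ _).
by field; exact: cone_neq0.
Qed.

Lemma theta_eq0 w X : cone w -> (forall k, theta w X k = 0) -> X = hor w X.1.
Proof.
move=> cw hX; rewrite [LHS]surjective_pairing; congr pair.
apply/rowP => k; rewrite mxE -/(ycoord k X).
have y0 := cone_neq0 k cw.
apply: (mulIf (invr_neq0 y0)); apply/eqP; rewrite -subr_eq0 -(hX k).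
by rewrite /theta /xcoord; apply/eqP; field; exact: y0.
Qed.

Lemma hor_smooth (x : V -> E) :
  smooth_on cone x -> smooth_on cone (fun w => hor w (x w)).
Proof.
move=> sx k; have Cx j := Ck_entry cone_open j (sx k).
apply: (Ck_pair cone_open) => // j.
have C : Ck k cone (fun w => - ycoord j w * (acoef j w * x w 0 j)).
  apply: (CkM cone_open); first by apply: (CkN cone_open); exact: Ck_ycoord.
  by apply: (CkM cone_open) => //; exact: Ck_acoef.
by apply: (Ck_eq cone_open) C => w _; rewrite mxE.
Qed.

(** All frame components of [eta] are 1: their derivatives vanish and [cform1] applies. *)
Lemma conn_eta w X : cone w ->
  conn w X snd = \row_l (ycoord l w * theta w X l).
Proof.
move=> cw; apply/rowP => l; rewrite !mxE.
have e k y : cone y -> fcoord snd k y = 1.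
  by move=> cy; rewrite /fcoord -/(ycoord _ _) divff //; exact: cone_neq0.
have -> : 'D_X (fcoord snd l) w = 0.
  rewrite -(derive_cst (1 : R) w X); apply: near_eq_derive.
  by apply: (cone_near cw) => y cy; exact: e.
rewrite (_ : fcoord snd ^~ w = fun=> 1) ?cform1 ?add0r //.
by apply/funext => k; exact: e.
Qed.

Lemma theta_vert w (y : E) k : theta w (0, y) k = y 0 k / ycoord k w.
Proof. by rewrite /theta /xcoord /= mxE mulr0 addr0. Qed.

Lemma derive_fst (A : V -> V) w u : differentiable A w ->
  ('D_u A w).1 = 'D_u (fun y => (A y).1) w.
Proof.
move=> dA; have fc : continuous (fst : V -> E) by move=> y; exact: cvg_fst.
by have [_ <-] := is_derive_linear_comp u fc dA.
Qed.

Lemma conn0 w X : conn w X (fun=> 0) = 0.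
Proof.
apply/rowP => l; rewrite !mxE.
have e k : fcoord (fun=> 0) k = cst 0 :> (V -> R).
  by apply/funext => y; rewrite /fcoord mxE mul0r.
rewrite /cform /gform /wsum !e derive_cst /cst; ring.
Qed.

(** The flat derivative of Y_l = y_l times its frame component exceeds the derivative of the
    component by the product term on the right; the derivatives themselves cancel. *)
Lemma conn_hv_torsion (Y : V -> E) w (x : E) l : cone w -> smooth_on cone Y ->
  (conn w (0, x) Y - 'D_(0, x) Y w) 0 l / ycoord l w =
  cform (fcoord Y ^~ w) (fun k => x 0 k / ycoord k w) l
  - fcoord Y l w * (x 0 l / ycoord l w).
Proof.
move=> cw sY; have y0 := cone_neq0 l cw.
have dY : derivable Y w (0, x).
  by apply: diff_derivable; exact: smooth_on_diff cw.
rewrite 3!mxE derive_fcoord // (derive_mx dY) mxE.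
rewrite (funext (theta_vert w x)) /fcoord /ycoord /= -/(ycoord l w).
set c := cform _ _ _; field; exact: y0.
Qed.

End CartanAxioms.

(** * R^3 as a manifold with one chart, and its Finsler function *)

Section Geometry.
Context {R : realType}.
Notation E := 'rV[R]_3.
Notation V := (E * E)%type.

Definition R3 : atlas E :=
  @Atlas R E E unit (fun=> setT) (fun=> idfun) (fun=> idfun).

Notation TM := (R3 * (unit -> E))%type.
Notation vec := (unit -> E).
Notation vec2 := (unit -> V).

(** With a single chart, a tangent vector is a family indexed by [unit]. The maps [chz] and [pt]
    identify the tangent bundle with its model, and [loc], [loc2] read sections and fields there. *)
Definition chz (z : TM) : V := (z.1, z.2 tt).
Definition pt (w : V) : TM := (w.1, fun=> w.2).
Definition DR3 : set (tangent_bundle R3) := [set z | cone (chz z)].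
Notation DM := (dom_atlas DR3).
Definition loc (Y : TM -> vec) (w : V) : E := Y (pt w) tt.
Definition loc2 (X : TM -> vec2) (w : V) : V := X (pt w) tt.
Definition finsler_fun (z : tangent_bundle R3) : R := Floc (chz z).
Definition cartan_conn : pi_connection R3 :=
  fun z X Y _ => conn (chz z) (X tt) (loc Y).

Lemma unit_funE {T : Type} (v : unit -> T) : v = fun=> v tt.
Proof. by apply/funext; case. Qed.

Lemma chzK z : pt (chz z) = z.
Proof. by case: z => x v; rewrite /pt /chz /= -unit_funE. Qed.

Lemma ptK w : chz (pt w) = w.
Proof. by case: w. Qed.

Lemma DR3_pt w : cone w -> DR3 (pt w).
Proof. by case: w. Qed.

Lemma transitionE i j : transition R3 i j = id.
Proof. by []. Qed.

Lemma diff_id_E (x : E) v : 'd (id : E -> E) x v = v.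
Proof. by rewrite diff_val. Qed.

Lemma tangentP p v : tangent R3 p v.
Proof. by move=> i; split=> [/(_ I)//|[] _ _]; case: i; rewrite transitionE diff_id_E. Qed.

Lemma chart_invE i w : chart_inv DM i w = pt w.
Proof.
rewrite /= /pt; congr pair; apply/funext => j.
by rewrite asboolT // transitionE diff_id_E.
Qed.

Lemma chart_imageE i : chart DM i @` chart_dom DM i = cone.
Proof.
apply/seteqP; split=> [_ [z [_ Dz] <-]|w cw] /=; first by case: i.
exists (pt w); last by case: i w {cw} => [] [].
by split; [split => //; exact: tangentP|rewrite /DR3 /= ptK].
Qed.

Lemma transition2E i j : transition DM i j = id.
Proof.
apply/funext => w; rewrite -[LHS]/(chart DM j (chart_inv DM i w)) chart_invE.
by case: j w => -[].
Qed.

(** The only transition is the identity, so the transformation law is empty; membership in the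
    domain excludes the clause that forces components to be 0. *)
Lemma tangent2P z X : DR3 z -> tangent DM z X.
Proof.
move=> Dz i; split.
  by case; split=> //; split=> //; exact: tangentP.
by move=> j _ _; case: i; case: j; rewrite transition2E diff_val.
Qed.

Lemma deriv_alongE (W : normedModType R) (f : TM -> W) i z X :
  deriv_along DM f i z X = 'D_(X tt) (fun w => f (pt w)) (chz z).
Proof.
rewrite /deriv_along (_ : f \o chart_inv DM i = fun w => f (pt w)); first by case: i.
by apply/funext => w; rewrite -(chart_invE i).
Qed.

Lemma pi_fieldE Y : pi_field DR3 Y -> smooth_on cone (loc Y).
Proof.
move=> [_ /(_ tt)]; rewrite chart_imageE.
by rewrite (_ : (fun w => _) = loc Y) //; apply/funext => w; rewrite chart_invE.
Qed.

Lemma pi_fieldI Y : smooth_on cone (loc Y) -> pi_field DR3 Y.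
Proof.
move=> sY; split=> [z _|i]; first exact: tangentP.
rewrite chart_imageE (_ : (fun w => _) = loc Y) //.
by apply/funext => w; rewrite chart_invE; case: i.
Qed.

Lemma vector_fieldE X : vector_field DM X -> smooth_on cone (loc2 X).
Proof.
move=> [_ /(_ tt)]; rewrite chart_imageE.
by rewrite (_ : (fun w => _) = loc2 X) //; apply/funext => w; rewrite chart_invE.
Qed.

Lemma smooth_funE (W : normedModType R) (f : TM -> W) :
  smooth_fun DM f -> smooth_on cone (fun w => f (pt w)).
Proof.
move=> /(_ tt); rewrite chart_imageE.
rewrite (_ : f \o chart_inv DM tt = fun w => f (pt w)) //.
by apply/funext => w; rewrite -(chart_invE tt).
Qed.

Lemma smooth_funI (W : normedModType R) (f : TM -> W) :
  smooth_on cone (fun w => f (pt w)) -> smooth_fun DM f.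
Proof.
move=> sf i; rewrite chart_imageE.
rewrite (_ : f \o chart_inv DM i = fun w => f (pt w)) //.
by apply/funext => w; rewrite -(chart_invE i).
Qed.

Lemma bracketE X Y z : DR3 z -> bracket DM X Y z = fun=>
  'D_(loc2 X (chz z)) (loc2 Y) (chz z) - 'D_(loc2 Y (chz z)) (loc2 X) (chz z).
Proof.
move=> Dz; apply/funext => -[]; rewrite /bracket asboolT; last first.
  by split=> //; split=> //; exact: tangentP.
by rewrite !deriv_alongE /loc2 chzK.
Qed.

Definition fibre_comp (z : TM) (u : vec) (k : 'I_3) : R :=
  u tt 0 k / ycoord k (chz z).

Lemma fcoord_loc Y z k : fcoord (loc Y) k (chz z) = fibre_comp z (Y z) k.
Proof. by rewrite /fcoord /loc chzK. Qed.

(** Both one-variable derivatives run along lines in the fibre, so [derive1_line] turns them into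
    the directional derivatives of [Floc_hessian]. *)
Lemma finsler_metricE z u v : DR3 z ->
  finsler_metric finsler_fun z u v =
  finsler_fun z ^+ 2 * gform (fibre_comp z u) (fibre_comp z v).
Proof.
move=> Dz; rewrite /finsler_metric.
have e1 s : derive1 (fun t => finsler_fun (z.1, z.2 + s *: u + t *: v) ^+ 2) 0 =
    'D_(0, v tt) (fun b => Floc b ^+ 2) (chz z + s *: ((0, u tt) : V)).
  rewrite -(derive1_line (fun b : V => Floc b ^+ 2)).
  apply: (congr1 (fun h : R -> R => derive1 h 0)).
  apply/funext => t; rewrite /finsler_fun; congr (Floc _ ^+ 2).
  by apply: (congr2 pair); rewrite //= !scaler0 !addr0.
have e2 := derive1_line (fun a : V => 'D_(0, v tt) (fun b => Floc b ^+ 2) a)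
  (chz z) (0, u tt).
rewrite (funext e1) [X in _ * X]e2; exact: Floc_hessian.
Qed.

Lemma manifold_R3 : is_smooth_manifold R3.
Proof.
have im (i : unit) U : chart R3 i @` (setT `&` U) = U.
  apply/seteqP; split=> [_ [x [_ Ux] <-]|x Ux] //; by exists x.
split=> //.
- by move=> i j; rewrite im; exact: (@openT E).
- move=> i j; rewrite im transitionE => k.
  by apply: (Ck_linear (@openT E) (L := idfun)) => x; exact: cvg_id.
- move=> p q _ _ pq; have /eqP {}pq : (p : E) <> q by [].
  have := @norm_hausdorff R E; rewrite open_hausdorff => /(_ p q pq).
  move=> [[A B] /= [pA qB] [oA oB /eqP AB]].
  exists A, B; rewrite !inE in pA qB.
  by split=> //; split=> [x _|i]; rewrite ?im //; exists tt.
- by exists (fun=> Some tt) => p _; exists 0%N, tt.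
Qed.

Lemma finsler_R3 : is_finsler DR3 finsler_fun.
Proof.
split.
- split=> [z Dz|i]; first by exists tt; split=> //; exact: tangentP.
  rewrite (_ : _ @` _ = cone); first exact: cone_open.
  exact: (chart_imageE i).
- exists (pt (0, const_mx 1)); rewrite /DR3 /= ptK => k.
  by rewrite /ycoord mxE.
- move=> z Dz z0; have := Dz o0; rewrite /chz /ycoord z0 /= mxE ltxx //.
- move=> z t Dz t0 k; have := Dz k; rewrite /ycoord /= mxE => yk.
  by rewrite mulr_gt0.
- by apply: smooth_funI; exact: Floc_smooth.
- by move=> z Dz; exact: Floc_gt0.
- move=> z t Dz t0; rewrite /finsler_fun /Floc /xcoord /ycoord /= !mxE.
  have y2 := cone_neq0 o2 Dz; have t1 : t != 0 by rewrite gt_eqF.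
  by field; rewrite t1 ?andbT; exact: y2.
- move=> z u Dz _ g0.
  have f0 : forall k, fibre_comp z u k = 0.
    apply: gform_nondegenerate => h.
    (* The test vector whose frame components are [h]; the factor F^2 > 0 can then be divided
       out. *)
    have := g0 (fun=> \row_k (h k * ycoord k (chz z))) (tangentP _ _).
    rewrite finsler_metricE // => /eqP; rewrite mulf_eq0 expf_eq0 /=.
    rewrite gt_eqF ?Floc_gt0 //= => /eqP e.
    rewrite -[RHS]e; congr gform; apply/funext => k.
    by rewrite /fibre_comp mxE mulfK //; exact: cone_neq0.
  rewrite (unit_funE u); apply/funext => -[]; apply/rowP => k; rewrite mxE.
  have /eqP := f0 k; rewrite mulf_eq0 invr_eq0 (negbTE (cone_neq0 k Dz)) orbF.
  by move/eqP.
Qed.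

End Geometry.

(** * The model connection is the Cartan connection *)

Section Cartan.
Context {R : realType}.
Notation E := 'rV[R]_3.
Notation V := (E * E)%type.
Notation R3 := (@R3 R).
Notation TM := (R3 * (unit -> E))%type.
Notation vec := (unit -> E).
Notation vec2 := (unit -> V).
Notation DR3 := (@DR3 R).
Notation DM := (dom_atlas DR3).
Notation cartan_conn := (@cartan_conn R).

Lemma connection_mapE (z : TM) X : DR3 z ->
  connection_map cartan_conn z X =
  fun=> \row_l (ycoord l (chz z) * theta (chz z) (X tt) l).
Proof. by move=> Dz; apply/funext => u; exact: conn_eta. Qed.

Lemma horizontalP (z : TM) X : DR3 z ->
  horizontal DR3 cartan_conn z X <-> forall k, theta (chz z) (X tt) k = 0.
Proof.
move=> Dz; rewrite /horizontal /= connection_mapE //; split=> [[_ K0] k|t0].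
  have := congr1 (fun v : vec => v tt 0 k) K0; rewrite /= !mxE => /eqP.
  by rewrite mulf_eq0 (negbTE (cone_neq0 k Dz)) /= => /eqP.
split; first exact: tangent2P.
by apply/funext => u; apply/rowP => k; rewrite !mxE t0 mulr0.
Qed.

(** The choice made by [xget] is forced, since [theta_eq0] determines a horizontal vector by its
    base component. *)
Lemma hliftE (z : TM) (x : vec) : DR3 z ->
  hlift DR3 cartan_conn z x = fun=> hor (chz z) (x tt).
Proof.
move=> Dz; apply: xget_unique.
  split; last by apply/funext => -[].
  by apply/(horizontalP _ Dz) => k; exact: theta_hor.
move=> X [/(horizontalP _ Dz) hX <-]; rewrite [LHS]unit_funE.
by apply/funext => _; exact: theta_eq0.
Qed.

(** On vertical vectors the factor y_k in K cancels the denominator of theta_k, so K is the identity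
    on fibre components. *)
Lemma vliftE (z : TM) (x : vec) : DR3 z ->
  vlift DR3 cartan_conn z x = fun=> (0, x tt).
Proof.
move=> Dz; have y0 k := cone_neq0 k Dz; apply: xget_unique.
  split; first by split; [exact: tangent2P|apply/funext].
  rewrite connection_mapE //; apply/funext => -[]; apply/rowP => k.
  by rewrite mxE theta_vert mulrC divfK.
move=> X [[_ X1]]; rewrite connection_mapE // => <-; rewrite [LHS]unit_funE.
have {}X1 : (X tt).1 = 0 by exact: (congr1 (fun v : vec => v tt) X1).
apply/funext => _; move: X1; case: (X tt) => a b /= ->.
by congr pair; apply/rowP => k; rewrite mxE theta_vert mulrC divfK.
Qed.

Lemma regularE : is_regular DR3 cartan_conn.
Proof.
move=> z Dz; split.
  (* The horizontal part is the lift of the base component; the remainder is vertical. *)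
  move=> X _; exists (fun=> (0, (X tt).2 - (hor (chz z) (X tt).1).2)),
    (fun=> hor (chz z) (X tt).1); split.
  - by split; [exact: tangent2P|apply/funext].
  - by apply/(horizontalP _ Dz) => k; exact: theta_hor.
  - apply/funext => -[]; rewrite -[RHS]/(_ + _) /=; case: (X tt) => a b.
    by apply: (congr2 pair); rewrite /= ?add0r ?subrK.
apply/seteqP; split=> [X [[_ X1] /(horizontalP _ Dz) hX]|X ->] /=.
  have {}X1 : (X tt).1 = 0 by exact: (congr1 (fun v : vec => v tt) X1).
  rewrite (unit_funE X) (theta_eq0 Dz hX) X1; apply/funext => u.
  by rewrite -[RHS]/((0, 0) : V); congr pair; apply/rowP => k; rewrite !mxE !mulr0.
split; first by split; [exact: tangent2P|apply/funext].
apply/(horizontalP _ Dz) => k.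
by rewrite (theta_vert (chz z) 0) mxE mul0r.
Qed.

Lemma linear_cartan : is_linear_connection DR3 cartan_conn.
Proof.
split.
- by move=> *; exact: tangentP.
- move=> z X Y Y' Dz _ _ _ YY'; apply/funext => u.
  by apply: conn_eq => // y cy; rewrite /loc YY' //; exact: DR3_pt.
- move=> z a X X' Y Dz _ _ /pi_fieldE sY; apply/funext => u.
  exact: conn_linear_model.
- move=> z X Y Y' Dz _ /pi_fieldE sY /pi_fieldE sY'; apply/funext => u.
  exact: conn_add_model.
- move=> z X f Y i Dz _ /smooth_funE sf /pi_fieldE sY _; apply/funext => -[].
  rewrite deriv_alongE /cartan_conn.
  have := conn_leibniz_model (X tt) Dz sf sY.
  by rewrite /loc chzK.
- move=> X Y /vector_fieldE sX /pi_fieldE sY; apply: pi_fieldI.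
  rewrite (_ : loc _ = fun w => conn w (loc2 X w) (loc Y)).
    exact: conn_smooth.
  by apply/funext => -[].
Qed.

(** The vertical lift projects to 0, which kills the second term of the torsion and reduces the
    projected bracket to a vertical derivative of [Y]. The lifts have their explicit form only on
    [cone], which suffices for derivatives at its points. *)
Lemma hv_torsionE (X Y : TM -> vec) (z : TM) : DR3 z ->
  smooth_on cone (loc X) -> smooth_on cone (loc Y) ->
  hv_torsion DR3 cartan_conn X Y z tt =
  conn (chz z) (0, X z tt) (loc Y) - 'D_(0, X z tt) (loc Y) (chz z).
Proof.
move=> Dz sX sY; rewrite /hv_torsion /torsion bracketE // hliftE // vliftE //.
have eh y : cone y -> loc2 (fun z => hlift DR3 cartan_conn z (Y z)) y = hor y (loc Y y).
  by move=> cy; rewrite /loc2 hliftE ?ptK //; exact: DR3_pt.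
have ev y : cone y -> loc2 (fun z => vlift DR3 cartan_conn z (X z)) y = (0, loc X y).
  by move=> cy; rewrite /loc2 vliftE ?ptK //; exact: DR3_pt.
have svert : smooth_on cone (fun y => ((0, loc X y) : V)).
  move=> k; apply: (Ck_pair cone_open) => j; last exact: (Ck_entry cone_open).
  by apply: (Ck_eq cone_open _ (Ck_cst cone_open (0 : R) k)) => y _; rewrite mxE.
have c1 u : conn (chz z) u (loc (fun w => pi_push (hlift DR3 cartan_conn w (Y w)))) =
    conn (chz z) u (loc Y).
  by apply: conn_eq => // y cy; exact: (congr1 fst (eh y cy)).
have c2 u : conn (chz z) u (loc (fun w => pi_push (vlift DR3 cartan_conn w (X w)))) = 0.
  rewrite -(conn0 (chz z) u); apply: conn_eq => // y cy.
  exact: (congr1 fst (ev y cy)).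
have c3 u : ('D_u (loc2 (fun z => hlift DR3 cartan_conn z (Y z))) (chz z)).1 =
    'D_u (loc Y) (chz z).
  rewrite (near_eq_derive _ (cone_near Dz eh)) derive_fst //.
  exact: (smooth_on_diff (hor_smooth sY) Dz).
have c4 u : ('D_u (loc2 (fun z => vlift DR3 cartan_conn z (X z))) (chz z)).1 = 0.
  rewrite (near_eq_derive _ (cone_near Dz ev)) derive_fst; first exact: derive_cst.
  exact: (smooth_on_diff svert Dz).
rewrite -[LHS]/(conn (chz z) (0, X z tt)
    (loc (fun w => pi_push (hlift DR3 cartan_conn w (Y w)))) -
  conn (chz z) (hor (chz z) (Y z tt))
    (loc (fun w => pi_push (vlift DR3 cartan_conn w (X w)))) -
  (('D_(loc2 (fun z => vlift DR3 cartan_conn z (X z)) (chz z))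
     (loc2 (fun z => hlift DR3 cartan_conn z (Y z))) (chz z)).1 -
   ('D_(loc2 (fun z => hlift DR3 cartan_conn z (Y z)) (chz z))
     (loc2 (fun z => vlift DR3 cartan_conn z (X z))) (chz z)).1)).
have fin (a b c d a' c' : E) :
    a = a' -> b = 0 -> c = c' -> d = 0 -> a - b - (c - d) = a' - c'.
  by move=> -> -> -> ->; rewrite !subr0.
have ev' : loc2 (fun z => vlift DR3 cartan_conn z (X z)) (chz z) = (0, X z tt).
  by rewrite ev // /loc chzK.
apply: fin (c1 _) (c2 _) _ (c4 _).
by apply: etrans (c3 _) _; rewrite ev'.
Qed.

Lemma cartan_R3 : is_cartan DR3 cartan_conn finsler_fun.
Proof.
split; [exact: linear_cartan|exact: regularE| | |].
- move=> z X Y Z i Dz _ /pi_fieldE sY /pi_fieldE sZ _.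
  rewrite deriv_alongE !finsler_metricE //.
  have := conn_metrical (X tt) Dz sY sZ.
  rewrite (funext (fcoord_loc Y z)) (funext (fcoord_loc Z z)) => <-.
  apply: near_eq_derive; apply: (cone_near Dz) => w cw.
  rewrite finsler_metricE; last exact: DR3_pt.
  by rewrite /finsler_fun ptK.
- move=> X Y /vector_fieldE sX /vector_fieldE sY hX hY z Dz.
  have hor0 (A : TM -> vec2) :
      (forall w, DR3 w -> horizontal DR3 cartan_conn w (A w)) ->
      forall y, cone y -> forall k, theta y (loc2 A y) k = 0.
    move=> hA y cy; have Dy := DR3_pt cy.
    by have /(horizontalP _ Dy) := hA _ Dy; rewrite ptK.
  apply/funext => -[].
  have := conn_torsion Dz sX sY (hor0 X hX) (hor0 Y hY).
  by rewrite /torsion bracketE // /loc2 chzK.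
- move=> X Y Z /pi_fieldE sX /pi_fieldE sY /pi_fieldE sZ z Dz.
  (* In the frame the torsion is the expression whose symmetry is [gform_cform_sym]. *)
  have key (A : TM -> vec) : smooth_on cone (loc A) ->
      fibre_comp z (hv_torsion DR3 cartan_conn X A z) = fun k =>
      cform (fibre_comp z (A z)) (fibre_comp z (X z)) k
      - fibre_comp z (A z) k * fibre_comp z (X z) k.
    move=> sA; apply/funext => l.
    have := conn_hv_torsion (X z tt) l Dz sA.
    rewrite (funext (fcoord_loc A z)) fcoord_loc => <-.
    by rewrite /fibre_comp hv_torsionE.
  have kE A B (sA : smooth_on cone (loc A)) := etrans
    (finsler_metricE (hv_torsion DR3 cartan_conn X A z) (B z) Dz)
    (congr1 (fun f => finsler_fun z ^+ 2 * gform f (fibre_comp z (B z))) (key A sA)).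
  apply: etrans (kE Y Z sY) _; apply: etrans _ (esym (kE Z Y sZ)).
  exact: (congr1 ( *%R _) (gform_cform_sym _ _ _)).
Qed.

End Cartan.

(** * The h-curvature at a point, and a vector separating the two spaces *)

Section Conclusion.
Context {R : realType}.
Notation E := 'rV[R]_3.
Notation V := (E * E)%type.
Notation R3 := (@R3 R).
Notation TM := (R3 * (unit -> E))%type.
Notation vec := (unit -> E).
Notation vec2 := (unit -> V).
Notation DR3 := (@DR3 R).
Notation DM := (dom_atlas DR3).
Notation cartan_conn := (@cartan_conn R).


(** Constant components in the global chart give an extension, so [extend] does not fall back on its
    default value. *)
Lemma extendP (z : TM) (x : vec) : DR3 z ->
  pi_field DR3 (extend DR3 z x) /\ extend DR3 z x z = x.
Proof.
move=> Dz; apply: (@xgetPex _ _ [set X | pi_field DR3 X /\ X z = x]).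
exists (cst x); split=> //; apply: pi_fieldI => k.
exact: (Ck_cst cone_open (x tt)).
Qed.

(** Near [z] the chosen lifts coincide with the smooth fields [hor], to which [conn_curvature]
    applies. *)
Lemma h_curvatureE (X Y Z : TM -> vec) (z : TM) : DR3 z ->
  smooth_on cone (loc X) -> smooth_on cone (loc Y) -> smooth_on cone (loc Z) ->
  h_curvature DR3 cartan_conn X Y Z z = fun=>
  - \row_l (ycoord l (chz z) *
            cform (fibre_comp z (Z z)) (twist (X z tt) (Y z tt)) l).
Proof.
move=> Dz sX sY sZ; apply/funext => -[].
have locz (A : TM -> vec) : loc A (chz z) = A z tt by rewrite /loc chzK.
pose lift (A : TM -> vec) (y : V) : V := hor y (loc A y).
have liftE (A : TM -> vec) y : cone y ->
    loc2 (fun w => hlift DR3 cartan_conn w (A w)) y = lift A y.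
  by move=> cy; rewrite /loc2 hliftE ?ptK //; exact: DR3_pt.
have liftz (A : TM -> vec) : hlift DR3 cartan_conn z (A z) tt = lift A (chz z).
  by rewrite hliftE // /lift locz.
have slift (A : TM -> vec) : smooth_on cone (loc A) -> smooth_on cone (lift A).
  exact: hor_smooth.
have hlift0 (A : TM -> vec) y : cone y -> forall k, theta y (lift A y) k = 0.
  by move=> cy k; exact: theta_hor.
have dlift (A B : TM -> vec) :
    'D_(loc2 (fun w => hlift DR3 cartan_conn w (A w)) (chz z))
       (loc2 (fun w => hlift DR3 cartan_conn w (B w))) (chz z) =
    'D_(lift A (chz z)) (lift B) (chz z).
  rewrite [X in derive _ _ X]liftE //; apply: near_eq_derive.
  by apply: (cone_near Dz) => y cy; exact: liftE.
have step (A B : TM -> vec) :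
    conn (chz z) (hlift DR3 cartan_conn z (A z) tt)
      (loc (fun w => cartan_conn w (hlift DR3 cartan_conn w (B w)) Z)) =
    conn (chz z) (lift A (chz z)) (fun y => conn y (lift B y) (loc Z)).
  rewrite liftz; apply: conn_eq => // y cy.
  rewrite -(liftE B y cy) /loc2.
  by rewrite -[LHS]/(conn (chz (pt y)) _ _) ptK.
have br : bracket DM (fun w => hlift DR3 cartan_conn w (X w))
    (fun w => hlift DR3 cartan_conn w (Y w)) z tt =
    'D_(lift X (chz z)) (lift Y) (chz z) - 'D_(lift Y (chz z)) (lift X) (chz z).
  rewrite (bracketE _ _ Dz).
  exact: (congr2 (fun a b : V => a - b) (dlift X Y) (dlift Y X)).
have fin (a b c a' b' c' : E) :
    a = a' -> b = b' -> c = c' -> a - b - c = a' - b' - c'.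
  by move=> -> -> ->.
apply: etrans (fin _ _ _ _ _ _ (step X Y) (step Y X)
  (congr1 (fun v => conn (chz z) v (loc Z)) br)) _.
apply: etrans (conn_curvature Dz (slift X sX) (slift Y sY) sZ (hlift0 X) (hlift0 Y)) _.
by rewrite (funext (fcoord_loc Z z)) /lift /hor /= !locz.
Qed.

(** The formula of [h_curvatureE] involves the sections only through their values at [z], so the
    choices made by [extend] disappear. *)
Lemma h_curvature_atE (z : TM) (x y w : vec) : DR3 z ->
  h_curvature_at DR3 cartan_conn z x y w = fun=>
  - \row_l (ycoord l (chz z) * cform (fibre_comp z w) (twist (x tt) (y tt)) l).
Proof.
move=> Dz; have [/pi_fieldE sx ex] := extendP x Dz.
have [/pi_fieldE sy ey] := extendP y Dz; have [/pi_fieldE sw ew] := extendP w Dz.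
rewrite /h_curvature_at h_curvatureE //.
by rewrite ex ey ew.
Qed.

(** At y = (1, 1, 1) the frame e_k is the standard basis. *)
Definition base_point : TM := pt (0, const_mx 1).

Lemma base_point_DR3 : DR3 base_point.
Proof. by apply: DR3_pt => k; rewrite /ycoord mxE. Qed.

Definition basis_vec (k : 'I_3) : vec := fun=> delta_mx 0 k.

(** The 2-forms d theta_k involve dx_1 and dx_2 only, so [twist] vanishes as soon as one argument is
    e_3. *)
Lemma nullity_e3 : nullity_space DR3 cartan_conn base_point (basis_vec o2).
Proof.
have Dz := base_point_DR3.
exists (fun=> hor (chz base_point) (basis_vec o2 tt)); last by apply/funext.
split; first by apply/(horizontalP _ Dz) => k; exact: theta_hor.
move=> Y w _ _; rewrite h_curvature_atE //.
have t0 y : twist (basis_vec o2 tt) y = fun=> 0.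
  apply/funext => k; rewrite /twist /basis_vec /= !mxE /=.
  by elim/ord3_ind: k => /=; ring.
rewrite [pi_push _]/(basis_vec o2) t0.
apply/funext => u; apply/rowP => l; rewrite !mxE cform0 mulr0.
by rewrite oppr0.
Qed.

(** The twist of e_1 and e_2 is t = (1, -1, 0), with [wsum t] = 0 and [gform] of e_3 and t equal to
    0. Of the connection form only [wsum] of e_3 times t survives, that is -t, so R(e_1, e_2) e_3 =
    t has first component 1. *)
Lemma kernel_e3 : ~ kernel_space DR3 cartan_conn base_point (basis_vec o2).
Proof.
have Dz := base_point_DR3.
move=> [_ ker]; have hP k : horizontal DR3 cartan_conn base_point
    (fun=> hor (chz base_point) (basis_vec k tt)).
  by apply/(horizontalP _ Dz) => j; exact: theta_hor.
have := ker _ _ (hP o0) (hP o1); rewrite h_curvature_atE //.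
move=> /(congr1 (fun v : vec => v tt 0 o0)).
rewrite !mxE /cform /gform /wsum /twist.
rewrite /fibre_comp /pi_push /hor /basis_vec /ycoord /= !mxE /=.
move=> h; have /eqP := oner_neq0 R; apply.
rewrite -[RHS]h invr1; ring.
Qed.

End Conclusion.

Theorem theorem2p4 (R : realType) :
  exists (n : nat) (M : atlas 'rV[R]_n)
         (D : set (tangent_bundle M)) (F : tangent_bundle M -> R)
         (nabla : pi_connection M) (z : tangent_bundle M),
    is_smooth_manifold M /\ is_finsler D F /\ is_cartan D nabla F /\ D z /\
    nullity_space D nabla z <> kernel_space D nabla z.
Proof.
exists 3, R3, (@DR3 R), finsler_fun, cartan_conn, base_point.
split; first exact: manifold_R3.
split; first exact: finsler_R3.
split; first exact: cartan_R3.
split; first exact: base_point_DR3.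
by move=> nk; apply: (@kernel_e3 R); rewrite -nk; exact: nullity_e3.
Qed.
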